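(* Let $\beta:Y\to Z$ be a dynamical Belyĭ map, let $\pi_1^Y=\pi_1(Y\setminus\{0,1,\infty\},1/2)$ and $\pi_1^Z=\pi_1(Z\setminus\{0,1,\infty\},1/2)$, let $\rho_\beta:\pi_1^Z\to\mathrm{Sym}(E_\beta)$ be the monodromy representation of $\beta$, $\mathrm{Mon}\,\beta=\rho_\beta(\pi_1^Z)$, $\tau_\lambda=\rho_\beta(\lambda)$, and let $f_\lambda$ be the extending pattern of $\beta$ from $\lambda$. Let $\mathrm{Mon}\,\beta$ act on $\mathrm{Fun}(E_\beta,\pi_1^Y)$ by $f^\tau(e_\beta)=f(e_\beta^{\tau^{-1}})$, and form the wreath product $\pi_1^Y\wr_{E_\beta}\mathrm{Mon}\,\beta=\mathrm{Fun}(E_\beta,\pi_1^Y)\rtimes\mathrm{Mon}\,\beta$ with multiplication $(f_1,\tau_1)(f_2,\tau_2)=(f_1\cdot f_2^{\tau_1^{-1}},\tau_1\tau_2)$ (pointwise product of functions). For $\lambda\in\pi_1^Z$ define $\varphi_\beta(\lambda)=f_\lambda\rtimes\tau_\lambda$. Then $\varphi_\beta:\pi_1^Z\to\pi_1^Y\wr_{E_\beta}\mathrm{Mon}\,\beta$ is a homomorphism whose image is an extension by $\mathrm{Mon}\,\beta$ of \[ \ker\big(\mathrm{proj}_\beta|_{\varphi_\beta(\pi_1^Z)}\big)=\varphi_\beta(\ker\rho_\beta)\cong\ker\rho_\beta/\ker\varphi_\beta, \] where $\mathrm{proj}_\beta$ is the projection onto the $\mathrm{Mon}\,\beta$ fa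ctor.
   Context: A Belyĭ map is a meromorphic function from a compact Riemann surface to $\mathbb{P}^1(\mathbb{C})$ unbranched outside $\{0,1,\infty\}$; a dynamical Belyĭ map is a Belyĭ map $\beta:\mathbb{P}^1(\mathbb{C})\to\mathbb{P}^1(\mathbb{C})$ with $\beta(\{0,1,\infty\})\subseteq\{0,1,\infty\}$; here $Y$ and $Z$ denote its domain and codomain copies of $\mathbb{P}^1(\mathbb{C})$. An edge of $\beta$ is a continuous $e:[0,1]\to\beta^{-1}([0,1])$ with $\beta\circ e=\mathrm{id}_{[0,1]}$; $E_\beta$ is the set of edges. Permutations act on the right and compose left to right; the monodromy action of a loop $\lambda\in\pi_1^Z$ sends an edge $e$ to the edge $e^\lambda$ containing the endpoint of the lift of $\lambda$ by $\beta$ starting at $e(1/2)$, and $\rho_\beta(\lambda)$ is this permutation. Construction: for a path $p$ in $P_*=\mathbb{P}^1(\mathbb{C})\setminus\{0,1,\infty\}$ and $j\in\{0,1\}$, let $\alpha_{p,j}$ be the path from $p(j)$ to $1/2$ which is the upper semicircular arc with diameter between $p(j)$ and $1/2$ if $p(j)\in(-\infty,0)\cup(1,\infty)$, and the straight segment otherwise; set $p^{\circlearrowleft}=\alpha_{p,0}^{-1}*p*\alpha_{p,1}\in\pi_1(P_*,1/2)$. Extending pattern: $f_\lambda:E_\beta\to\pi_1^Y$, $f_\lambda(e_\beta)=\lambda_Y^{\circlearrowleft}$, where $\lambda_Y$ is the lift of $\lambda$ by $\beta$ with $\lambda_Y(0)=e_\beta(1/2)$. ''An extension by $Q$ of $N$''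 means $N$ is a normal subgroup with quotient $Q$. *)

(* Defs.v *)
From HB Require Import structures.
From mathcomp Require Import all_boot all_order all_algebra.
From mathcomp Require Import generic_quotient ring lra.
From mathcomp Require Import all_classical all_reals.
From mathcomp Require Import topology normedtype sequences trigo homotopy.
From mathcomp Require Import complex.

Set Implicit Arguments.
Unset Strict Implicit.
Unset Printing Implicit Defensive.

Import Order.TTheory GRing.Theory Num.Theory numFieldNormedType.Exports.

Local Open Scope classical_set_scope.
Local Open Scope ring_scope.
Local Open Scope quotient_scope.
Local Open Scope complex_scope.

Definition I01 (R : realType) : Type := set_type (`[0%R : R, 1%R]%classic).

HB.instance Definition _ (R : realType) :=
  Topological.copy (I01 R) (set_type (`[0%R : R, 1%R]%classic)).

Definition ival (R : realType) (t : I01 R) : R := \val t.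

Section unit_interval.
Context (R : realType).
Implicit Types (t : I01 R) (x : R).

Lemma clamp_subproof x : Num.max 0 (Num.min 1 x) \in `[0%R : R, 1%R]%classic.
Proof.
by apply/mem_set; rewrite /= in_itv /= le_max lexx ge_max ler01 ge_min lexx.
Qed.

Definition clamp x : I01 R := exist _ (Num.max 0 (Num.min 1 x)) (clamp_subproof x).

Lemma ival_ge0 t : 0 <= ival t.
Proof. by have := set_mem (valP t); rewrite /= in_itv /= => /andP[]. Qed.

Lemma ival_le1 t : ival t <= 1.
Proof. by have := set_mem (valP t); rewrite /= in_itv /= => /andP[]. Qed.

Lemma ival_inj : injective (@ival R).
Proof. exact: val_inj. Qed.

Lemma ival_clamp x : ival (clamp x) = Num.max 0 (Num.min 1 x).
Proof. by []. Qed.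

Lemma clampK x : 0 <= x <= 1 -> ival (clamp x) = x.
Proof. by move=> /andP[x0 x1]; rewrite ival_clamp min_r // max_r. Qed.

Lemma ivalK t : clamp (ival t) = t.
Proof. by apply: ival_inj; rewrite clampK // ival_ge0 ival_le1. Qed.

Lemma ival_continuous : continuous (@ival R).
Proof. exact: initial_continuous. Qed.

Lemma clamp_continuous : continuous clamp.
Proof.
apply: continuous_comp_initial => x.
apply: continuous_max; first exact: cvg_cst.
apply: continuous_min; first exact: cvg_cst.
exact: cvg_id.
Qed.

Lemma I01_zero_neq_one : clamp 0 != clamp 1.
Proof.
by apply/eqP => /(congr1 (@ival R)); rewrite !clampK ?lexx ?ler01//; lra.
Qed.

HB.instance Definition _ := Choice.copy (I01 R) (set_type (`[0%R : R, 1%R]%classic)).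
HB.instance Definition _ := isBiPointed.Build (I01 R) I01_zero_neq_one.

Lemma ival0 : ival (zero : I01 R) = 0.
Proof. by rewrite clampK // lexx ler01. Qed.

Lemma ival1 : ival (one : I01 R) = 1.
Proof. by rewrite clampK // lexx ler01. Qed.
End unit_interval.

Section continuity.
Context (R : realType) (T : topologicalType).
Implicit Types f g : T -> R.

Lemma continuous_addf f g :
  continuous f -> continuous g -> continuous (fun t => f t + g t).
Proof. by move=> cf cg t; exact: (@cvgD _ R^o _ _ _ f g _ _ (cf t) (cg t)). Qed.

Lemma continuous_subf f g :
  continuous f -> continuous g -> continuous (fun t => f t - g t).
Proof. by move=> cf cg t; exact: (@cvgB _ R^o _ _ _ f g _ _ (cf t) (cg t)). Qed.

Lemma continuous_mulf f g :
  continuous f -> continuous g -> continuous (fun t => f t * g t).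
Proof. by move=> cf cg t; exact: (@cvgM _ _ _ _ f g _ _ (cf t) (cg t)). Qed.

Lemma continuous_clampf f : continuous f -> continuous (fun t => clamp (f t)).
Proof.
by move=> cf t; apply: (@continuous_comp _ _ _ f (@clamp R)); [exact: cf|
  exact: clamp_continuous].
Qed.

Lemma continuous_ivalf (f : T -> I01 R) :
  continuous f -> continuous (fun t => ival (f t)).
Proof.
by move=> cf t; apply: (@continuous_comp _ _ _ f (@ival R)); [exact: cf|
  exact: ival_continuous].
Qed.

Lemma continuous_minf f g :
  continuous f -> continuous g -> continuous (fun t => Num.min (f t) (g t)).
Proof. by move=> cf cg t; exact: continuous_min (cf t) (cg t). Qed.

Lemma continuous_maxf f g :
  continuous f -> continuous g -> continuous (fun t => Num.max (f t) (g t)).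
Proof. by move=> cf cg t; exact: continuous_max (cf t) (cg t). Qed.

Lemma continuous_funcomp (U V : topologicalType) (k : T -> U) (h : U -> V) :
  continuous k -> continuous h -> continuous (fun t => h (k t)).
Proof. by move=> ck ch t; apply: (@continuous_comp _ _ _ k h); [exact: ck|exact: ch]. Qed.

Lemma continuous_pairf (U V : topologicalType) (k : T -> U) (h : T -> V) :
  continuous k -> continuous h -> continuous (fun t => (k t, h t)).
Proof. by move=> ck ch t; apply: cvg_pair; [exact: ck | exact: ch]. Qed.

Lemma continuous_cstf (U : topologicalType) (u : U) : continuous (fun _ : T => u).
Proof. by move=> t; exact: cvg_cst. Qed.

End continuity.

Ltac continuity := repeat first
  [ exact: continuous_cstf | assumption | exact: ival_continuous
  | exact: cts_fun
  | apply: continuous_subf | apply: continuous_addf | apply: continuous_mulf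
  | apply: continuous_minf | apply: continuous_maxf
  | apply: continuous_clampf | apply: continuous_ivalf ].

Section paths.
Context (R : realType) (X : topologicalType).
Implicit Types x y z : X.

Local Notation I := (I01 R).
Local Notation path x y := {path I from x to y in X}.

Section reverse.
Context (x y : X) (p : path x y).

Definition rev_path (t : I) : X := p (clamp (1 - ival t)).

Lemma rev_path_continuous : continuous rev_path.
Proof.
apply: (continuous_funcomp (k := fun t : I => clamp (1 - ival t)) (h := p)).
  by continuity.
exact: cts_fun.
Qed.

Lemma rev_path_zero : rev_path zero = y.
Proof. by rewrite /rev_path ival0 subr0; exact: (@path_one _ _ _ _ p). Qed.

Lemma rev_path_one : rev_path one = x.
Proof. by rewrite /rev_path ival1 subrr; exact: (@path_zero _ _ _ _ p). Qed.

HB.instance Definition _ := isContinuous.Build I X rev_path rev_path_continuous.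
HB.instance Definition _ := isPath.Build I X y x rev_path rev_path_zero rev_path_one.
End reverse.

Lemma glue_continuous (T : topologicalType) (g : T -> R) (f1 f2 : T -> X) :
  continuous g -> continuous f1 -> continuous f2 ->
  (forall t, g t = 0 -> f1 t = f2 t) ->
  continuous (fun t => if g t <= 0 then f1 t else f2 t).
Proof.
move=> cg c1 c2 E t V /= Vt.
suff : \forall u \near t, V (if g u <= 0 then f1 u else f2 u) by [].
move: Vt; case: (ltrgtP (g t) 0) => [gt|gt|gt] Vt.
- have K : \forall u \near t, V (f1 u) by exact: (c1 t _ Vt).
  have H : \forall u \near t, g u < 0 by exact: (cg t _ (lt_nbhsl gt)).
  near=> u.
  have gu : g u < 0 by near: u.
  by rewrite (ltW gu); near: u.
- have K : \forall u \near t, V (f2 u) by exact: (c2 t _ Vt).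
  have H : \forall u \near t, 0 < g u by exact: (cg t _ (lt_nbhsr gt)).
  near=> u.
  have gu : 0 < g u by near: u.
  by rewrite leNgt gu; near: u.
- have K1 : \forall u \near t, V (f1 u) by exact: (c1 t _ Vt).
  have K2 : \forall u \near t, V (f2 u) by apply: c2; rewrite -E.
  by near=> u; case: ifP => _; near: u.
Unshelve. all: by end_near. Qed.

Section concatenation.
Context (x y z : X) (p : path x y) (q : path y z).

Definition conc_path (t : I) : X :=
  if ival t <= 2^-1 then p (clamp (2 * ival t)) else q (clamp (2 * ival t - 1)).

Lemma conc_path_continuous : continuous conc_path.
Proof.
rewrite (_ : conc_path = fun t => if ival t - 2^-1 <= 0 then
    p (clamp (2 * ival t)) else q (clamp (2 * ival t - 1))); last first.
  by apply/funext => t; rewrite /conc_path subr_le0.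
apply: (glue_continuous (f1 := fun t : I => p (clamp (2 * ival t)))
  (f2 := fun t : I => q (clamp (2 * ival t - 1)))) => [|||t].
- by continuity.
- apply: (continuous_funcomp (k := fun t : I => clamp (2 * ival t)) (h := p)).
    by continuity.
  exact: cts_fun.
- apply: (continuous_funcomp (k := fun t : I => clamp (2 * ival t - 1)) (h := q)).
    by continuity.
  exact: cts_fun.
- move/eqP; rewrite subr_eq0 => /eqP ->; rewrite mulfV ?pnatr_eq0// subrr.
  by rewrite -[clamp 0]/(zero) -[clamp 1]/(one) path_zero path_one.
Qed.

Lemma conc_path_zero : conc_path zero = x.
Proof. by rewrite /conc_path ival0 mulr0 invr_ge0 ler0n; exact: (@path_zero _ _ _ _ p). Qed.

Lemma conc_path_one : conc_path one = z.
Proof.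
rewrite /conc_path ival1 ifF; last by apply/negbTE; rewrite -ltNge; lra.
by rewrite (_ : 2 * 1 - 1 = 1 :> R); [exact: (@path_one _ _ _ _ q) | lra].
Qed.

HB.instance Definition _ := isContinuous.Build I X conc_path conc_path_continuous.
HB.instance Definition _ := isPath.Build I X x z conc_path conc_path_zero conc_path_one.
End concatenation.

Lemma rev_pathE x y (p : path x y) (t : I) :
  (rev_path p : path y x) t = p (clamp (1 - ival t)).
Proof. by []. Qed.

Lemma conc_pathE x y z (p : path x y) (q : path y z) (t : I) :
  (conc_path p q : path x z) t =
  if ival t <= 2^-1 then p (clamp (2 * ival t)) else q (clamp (2 * ival t - 1)).
Proof. by []. Qed.

Definition homotopic (x y : X) (p q : path x y) : Prop :=
  exists H : I * I -> X, [/\ continuous H,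
    forall t, H (zero, t) = p t, forall t, H (one, t) = q t,
    forall s, H (s, zero) = x & forall s, H (s, one) = y].

Lemma homotopic_refl x y (p : path x y) : homotopic p p.
Proof.
exists (fun u => p u.2); split => // [|s|s]; last 2 first.
- exact: path_zero.
- exact: path_one.
by apply: (continuous_funcomp (k := snd) (h := p)); [
  move=> u; exact: cvg_snd | exact: cts_fun].
Qed.

Lemma homotopic_sym x y (p q : path x y) : homotopic p q -> homotopic q p.
Proof.
move=> [H [cH H0 H1 Hx Hy]].
exists (fun u => H (clamp (1 - ival u.1), u.2)); split => [|t|t|s|s] //=.
- apply: (continuous_funcomp (k := fun u : I * I => (clamp (1 - ival u.1), u.2))) => //.
  apply: continuous_pairf; last by move=> u; exact: cvg_snd.
  have c1 : continuous (fst : I * I -> I) by move=> u; exact: cvg_fst.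
  by continuity.
- by rewrite ival0 subr0 H1.
- by rewrite ival1 subrr H0.
Qed.

Lemma homotopic_trans x y (q p r : path x y) :
  homotopic p q -> homotopic q r -> homotopic p r.
Proof.
move=> [H [cH H0 H1 Hx Hy]] [K [cK K0 K1 Kx Ky]].
have c1 : continuous (fst : I * I -> I) by move=> u; exact: cvg_fst.
have c2 : continuous (snd : I * I -> I) by move=> u; exact: cvg_snd.
exists (fun u => if ival u.1 - 2^-1 <= 0 then H (clamp (2 * ival u.1), u.2)
                 else K (clamp (2 * ival u.1 - 1), u.2)); split => [|t|t|s|s] /=.
- apply: (glue_continuous (f1 := fun u : I * I => H (clamp (2 * ival u.1), u.2))
    (f2 := fun u : I * I => K (clamp (2 * ival u.1 - 1), u.2))) => [|||u].
  + by continuity.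
  + apply: (continuous_funcomp (k := fun u : I * I => (clamp (2 * ival u.1), u.2))) => //.
    by apply: continuous_pairf => //; continuity.
  + apply: (continuous_funcomp (k := fun u : I * I => (clamp (2 * ival u.1 - 1), u.2))) => //.
    by apply: continuous_pairf => //; continuity.
  + move/eqP; rewrite subr_eq0 => /eqP ->; rewrite mulfV ?pnatr_eq0// subrr.
    by rewrite H1 K0.
- rewrite ival0 mulr0 ifT; last by lra.
  exact: H0.
- rewrite ival1 ifF; last by apply/negbTE; rewrite -ltNge; lra.
  by rewrite (_ : 2 * 1 - 1 = 1 :> R); [exact: K1 | lra].
- by case: ifP.
- by case: ifP.
Qed.

Lemma homotopic_conc x y z (p p' : path x y) (q q' : path y z) :
  homotopic p p' -> homotopic q q' ->
  homotopic (conc_path p q) (conc_path p' q').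
Proof.
move=> [H [cH H0 H1 Hx Hy]] [K [cK K0 K1 Kx Ky]].
have c1 : continuous (fst : I * I -> I) by move=> u; exact: cvg_fst.
have c2 : continuous (snd : I * I -> I) by move=> u; exact: cvg_snd.
exists (fun u => if ival u.2 - 2^-1 <= 0 then H (u.1, clamp (2 * ival u.2))
                 else K (u.1, clamp (2 * ival u.2 - 1))); split => [|t|t|s|s] /=.
- apply: (glue_continuous (f1 := fun u : I * I => H (u.1, clamp (2 * ival u.2)))
    (f2 := fun u : I * I => K (u.1, clamp (2 * ival u.2 - 1)))) => [|||u].
  + by continuity.
  + apply: (continuous_funcomp (k := fun u : I * I => (u.1, clamp (2 * ival u.2)))) => //.
    by apply: continuous_pairf => //; continuity.
  + apply: (continuous_funcomp (k := fun u : I * I => (u.1, clamp (2 * ival u.2 - 1)))) => //.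
    by apply: continuous_pairf => //; continuity.
  + move/eqP; rewrite subr_eq0 => /eqP ->; rewrite mulfV ?pnatr_eq0// subrr.
    by rewrite Hy Kx.
- by rewrite /conc_path subr_le0 H0 K0.
- by rewrite /conc_path subr_le0 H1 K1.
- rewrite ival0 mulr0 ifT; last by lra.
  exact: Hx.
- rewrite ival1 ifF; last by apply/negbTE; rewrite -ltNge; lra.
  by rewrite (_ : 2 * 1 - 1 = 1 :> R); [exact: Ky | lra].
Qed.

Lemma homotopic_rev x y (p q : path x y) :
  homotopic p q -> homotopic (rev_path p) (rev_path q).
Proof.
move=> [H [cH H0 H1 Hx Hy]].
exists (fun u => H (u.1, clamp (1 - ival u.2))); split => [|t|t|s|s] /=; rewrite ?H0 ?H1 //.
- apply: (continuous_funcomp (k := fun u : I * I => (u.1, clamp (1 - ival u.2)))) => //.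
  have c2 : continuous (snd : I * I -> I) by move=> u; exact: cvg_snd.
  by apply: continuous_pairf; [move=> u; exact: cvg_fst | continuity].
- by rewrite ival0 subr0 Hy.
- by rewrite ival1 subrr Hx.
Qed.

(* Two reparametrizations of the same path with the same endpoints are
   homotopic; all the group laws are instances. *)
Lemma homotopic_reparam x y x' y' (p : path x y) (a b : path x' y') (g h : I -> R) :
  continuous g -> continuous h ->
  g zero = h zero -> g one = h one ->
  (forall t, a t = p (clamp (g t))) -> (forall t, b t = p (clamp (h t))) ->
  homotopic a b.
Proof.
move=> cg ch gh0 gh1 ag bh.
have c1 : continuous (fst : I * I -> I) by move=> u; exact: cvg_fst.
have c2 : continuous (snd : I * I -> I) by move=> u; exact: cvg_snd.
pose k (u : I * I) := (1 - ival u.1) * g u.2 + ival u.1 * h u.2.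
exists (fun u => p (clamp (k u))); split => [|t|t|s|s]; rewrite /k /=.
- apply: (continuous_funcomp (k := fun u => clamp (k u)) (h := p)).
    apply: continuous_clampf; rewrite /k.
    have cgs : continuous (fun u : I * I => g u.2) by exact: continuous_funcomp.
    have chs : continuous (fun u : I * I => h u.2) by exact: continuous_funcomp.
    by continuity.
  exact: cts_fun.
- by rewrite ival0 subr0 mul1r mul0r addr0 -ag.
- by rewrite ival1 subrr mul1r mul0r add0r -bh.
- by rewrite -gh0 -mulrDl subrK mul1r -ag path_zero.
- by rewrite -gh1 -mulrDl subrK mul1r -ag path_one.
Qed.

End paths.

Section fundamental_group.
Context (R : realType) (X : topologicalType) (x : X).
Local Notation I := (I01 R).
Local Notation loop := {path I from x to x in X}.

Definition homotopicb (p q : loop) : bool := `[< homotopic p q >].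

Lemma homotopicb_equiv : equiv_class_of homotopicb.
Proof.
split=> [p|p q|q p r].
- by apply/asboolP; exact: homotopic_refl.
- by apply/asboolP/asboolP; exact: homotopic_sym.
- by move=> /asboolP pq /asboolP qr; apply/asboolP; exact: homotopic_trans pq qr.
Qed.

Canonical homotopy_equiv := EquivRelPack homotopicb_equiv.

Definition pi1 : Type := {eq_quot homotopy_equiv}.
HB.instance Definition _ := Choice.on pi1.
HB.instance Definition _ := Quotient.on pi1.

Definition pi1_class (p : loop) : pi1 := \pi_pi1 p.

Lemma pi1_classP (p q : loop) : pi1_class p = pi1_class q <-> homotopic p q.
Proof. by split=> [/eqmodP/asboolP|pq]; last exact/eqmodP/asboolP. Qed.

Lemma pi1_reprK (a : pi1) : pi1_class (repr a) = a.
Proof. exact: reprK. Qed.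

Definition pi1_one : pi1 := pi1_class (cst x).
Definition pi1_mul (a b : pi1) : pi1 := pi1_class (conc_path (repr a) (repr b)).
Definition pi1_inv (a : pi1) : pi1 := pi1_class (rev_path (repr a)).

Lemma pi1_mulE (p q : loop) :
  pi1_mul (pi1_class p) (pi1_class q) = pi1_class (conc_path p q).
Proof.
by apply/pi1_classP; apply: homotopic_conc; apply/pi1_classP; exact: pi1_reprK.
Qed.

Lemma pi1_invE (p : loop) : pi1_inv (pi1_class p) = pi1_class (rev_path p).
Proof. by apply/pi1_classP; apply: homotopic_rev; apply/pi1_classP; exact: pi1_reprK. Qed.

Ltac minmax :=
  repeat match goal with
  | |- context [Order.min ?a ?b] =>
    lazymatch constr:((a, b)) with
    | context [Order.min _ _] => fail
    | _ => case: (leP a b) => ?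
    end
  | |- context [Order.max ?a ?b] => case: (leP a b) => ?
  end; lra.

Lemma pi1_mulA : associative pi1_mul.
Proof.
move=> a b c; rewrite -(pi1_reprK a) -(pi1_reprK b) -(pi1_reprK c) !pi1_mulE.
move: (repr a) (repr b) (repr c) => p q r; apply/pi1_classP/homotopic_sym.
pose g (t : I) :=
  Num.min (2 * ival t) (Num.min (ival t + 4^-1) (2^-1 * (ival t + 1))).
apply: (homotopic_reparam (p := conc_path p (conc_path q r)) (g := g)
  (h := @ival R)).
- by rewrite /g; continuity.
- by continuity.
- by rewrite /g !ival0; minmax.
- by rewrite /g !ival1; minmax.
- move=> t; have t0 := ival_ge0 t; have t1 := ival_le1 t.
  rewrite !conc_pathE.
  have [th|th] := leP (ival t) 2^-1.
    rewrite (@clampK _ (2 * ival t)); last by lra.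
    have [tq|tq] := leP (2 * ival t) 2^-1.
      have -> : g t = 2 * ival t by rewrite /g; minmax.
      by rewrite clampK ?tq //; lra.
    have -> : g t = ival t + 4^-1 by rewrite /g; minmax.
    rewrite clampK; last by lra.
    rewrite ifF; last by apply/negbTE; rewrite -ltNge; lra.
    rewrite clampK; last by lra.
    rewrite ifT; last by lra.
    by congr (q (clamp _)); lra.
  have -> : g t = 2^-1 * (ival t + 1) by rewrite /g; minmax.
  rewrite (@clampK _ (2^-1 * (ival t + 1))); last by lra.
  rewrite ifF; last by apply/negbTE; rewrite -ltNge; lra.
  rewrite clampK; last by lra.
  rewrite ifF; last by apply/negbTE; rewrite -ltNge; lra.
  by congr (r (clamp _)); lra.
- by move=> t; rewrite ivalK.
Qed.

Lemma pi1_mul1 : right_id pi1_one pi1_mul.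
Proof.
move=> a; rewrite -(pi1_reprK a) pi1_mulE; apply/pi1_classP.
move: (repr a) => p.
apply: (homotopic_reparam (p := p) (g := fun t : I => Num.min 1 (2 * ival t))
  (h := @ival R)).
- by continuity.
- by continuity.
- by rewrite !ival0; minmax.
- by rewrite !ival1; minmax.
- move=> t; rewrite conc_pathE; have [th|th] := leP (ival t) 2^-1; first by rewrite min_r //; lra.
  by rewrite min_l; [rewrite [RHS](@path_one _ _ _ _ p) | lra].
- by move=> t; rewrite ivalK.
Qed.

Lemma pi1_mul1l : left_id pi1_one pi1_mul.
Proof.
move=> a; rewrite -(pi1_reprK a) pi1_mulE; apply/pi1_classP.
move: (repr a) => p.
apply: (homotopic_reparam (p := p) (g := fun t : I => Num.max 0 (2 * ival t - 1))
  (h := @ival R)).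
- by continuity.
- by continuity.
- by rewrite !ival0; minmax.
- by rewrite !ival1; minmax.
- move=> t; rewrite conc_pathE; have [th|th] := leP (ival t) 2^-1; last by rewrite max_r //; lra.
  by rewrite max_l; [rewrite [RHS](@path_zero _ _ _ _ p) | lra].
- by move=> t; rewrite ivalK.
Qed.

Lemma pi1_mulV : right_inverse pi1_one pi1_inv pi1_mul.
Proof.
move=> a; rewrite -(pi1_reprK a) pi1_invE pi1_mulE; apply/pi1_classP.
move: (repr a) => p.
apply: (homotopic_reparam (p := p)
  (g := fun t : I => Num.min (2 * ival t) (2 - 2 * ival t))
  (h := fun _ : I => 0)).
- by continuity.
- by continuity.
- by rewrite !ival0; minmax.
- by rewrite !ival1; minmax.
- move=> t; have t1 := ival_le1 t.
  rewrite conc_pathE; have [th|th] := leP (ival t) 2^-1; first by rewrite min_l //; lra.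
  rewrite rev_pathE clampK; last by lra.
  by congr (p (clamp _)); rewrite min_r; lra.
- by move=> t; rewrite [RHS](@path_zero _ _ _ _ p).
Qed.

Lemma pi1_mulVl : left_inverse pi1_one pi1_inv pi1_mul.
Proof.
move=> a; rewrite -(pi1_reprK a) pi1_invE pi1_mulE; apply/pi1_classP.
move: (repr a) => p.
apply: (homotopic_reparam (p := p)
  (g := fun t : I => Num.max (1 - 2 * ival t) (2 * ival t - 1))
  (h := fun _ : I => 1)).
- by continuity.
- by continuity.
- by rewrite !ival0; minmax.
- by rewrite !ival1; minmax.
- move=> t; have t0 := ival_ge0 t.
  rewrite conc_pathE; have [th|th] := leP (ival t) 2^-1; last by rewrite max_r //; lra.
  rewrite rev_pathE clampK; last by lra.
  by congr (p (clamp _)); rewrite max_l; lra.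
- by move=> t; rewrite [RHS](@path_one _ _ _ _ p).
Qed.

HB.instance Definition _ := isGroup.Build pi1
  pi1_mulA pi1_mul1l pi1_mul1 pi1_mulVl pi1_mulV.

End fundamental_group.

Section symmetric_group.
Context (T : Type).

Record Sym : Type := MkSym {
  sym_fun :> T -> T;
  sym_inv : T -> T;
  symK : cancel sym_fun sym_inv;
  symVK : cancel sym_inv sym_fun }.

HB.instance Definition _ := gen_eqMixin Sym.
HB.instance Definition _ := gen_choiceMixin Sym.

Lemma Sym_ext (s t : Sym) : s =1 t -> s = t.
Proof.
case: s t => [f f' fK fVK] [g g' gK gVK] /= /funext fg.
rewrite -{}fg in gK gVK *.
have f'g' : f' = g' by apply/funext => x; rewrite -[x in LHS]gVK fK.
rewrite -{}f'g' in gK gVK *.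
by congr MkSym; exact: Prop_irrelevance.
Qed.

(* Permutations act on the right and compose from left to right. *)
Definition Sym_mul (s t : Sym) : Sym :=
  MkSym (can_comp (symK t) (symK s)) (can_comp (symVK s) (symVK t)).
Definition Sym_one : Sym := @MkSym id id (fun=> erefl) (fun=> erefl).
Definition Sym_inv (s : Sym) : Sym := MkSym (symVK s) (symK s).

Lemma Sym_mulA : associative Sym_mul. Proof. by move=> s t u; exact: Sym_ext. Qed.
Lemma Sym_mul1l : left_id Sym_one Sym_mul. Proof. by move=> s; exact: Sym_ext. Qed.
Lemma Sym_mul1 : right_id Sym_one Sym_mul. Proof. by move=> s; exact: Sym_ext. Qed.
Lemma Sym_mulVl : left_inverse Sym_one Sym_inv Sym_mul.
Proof. by move=> s; apply: Sym_ext => x; exact: symVK. Qed.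
Lemma Sym_mulV : right_inverse Sym_one Sym_inv Sym_mul.
Proof. by move=> s; apply: Sym_ext => x; exact: symK. Qed.

HB.instance Definition _ := isGroup.Build Sym
  Sym_mulA Sym_mul1l Sym_mul1 Sym_mulVl Sym_mulV.

(* The permutation with graph f; the identity when f is not bijective. *)
Definition sym_of (f : T -> T) : Sym :=
  xget Sym_one [set s : Sym | sym_fun s = f].
End symmetric_group.

Section subgroups.
Context (G : groupType).

Definition is_subgroup (H : set G) : Prop :=
  [/\ H 1%g, forall x y, H x -> H y -> H (x * y)%g & forall x, H x -> H x^-1%g].

Record subgroup : Type := Subgroup {
  subgroup_set :> set G;
  subgroupP : is_subgroup subgroup_set }.

Lemma generated_subproof (S : set G) :
  is_subgroup [set x | forall H : subgroup, S `<=` H -> (H : set G) x].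
Proof.
split=> [H _|x y Hx Hy H SH|x Hx H SH]; case: (subgroupP H) => h1 hM hV //.
- by apply: hM; [exact: Hx | exact: Hy].
- by apply: hV; exact: Hx.
Qed.
Definition generated (S : set G) : subgroup := Subgroup (generated_subproof S).

Lemma sub_generated (S : set G) : S `<=` generated S.
Proof. by move=> x Sx H; exact. Qed.

Lemma generated_id (S : set G) : is_subgroup S -> generated S = S :> set G.
Proof.
move=> gS; rewrite eqEsubset; split; last exact: sub_generated.
by move=> x /(_ (Subgroup gS)); exact.
Qed.

Definition normal (N H : set G) : Prop :=
  [/\ is_subgroup N, is_subgroup H, N `<=` H &
      forall n h, N n -> H h -> N (h^-1 * n * h)%g].

(* Subsets of G under pointwise multiplication; the quotient H / N is the set
   of cosets h N, and for N normal in H it is a group under this product. *)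
Definition gset : Type := set G.
Definition gset_mul (A B : gset) : gset := [set (x * y)%g | x in A & y in B].
HB.instance Definition _ := hasMul.Build gset gset_mul.

Definition coset (N : set G) (x : G) : gset := [set (x * n)%g | n in N].
Definition quotient (H N : set G) : set gset := coset N @` H.
End subgroups.

Section subgroup_type.
Context (G : groupType) (H : subgroup G).

Definition subg : Type := set_type H.
HB.instance Definition _ := Choice.on subg.

Definition subg_val (x : subg) : G := \val x.
Definition Subg (x : G) (Hx : (H : set G) x) : subg := exist _ x (mem_set Hx).

Lemma subg_valP (x : subg) : (H : set G) (subg_val x).
Proof. exact: set_mem (valP x). Qed.

Lemma subg_val_inj : injective subg_val.
Proof. exact: val_inj. Qed.

Lemma subg1_subproof : (H : set G) 1%g. Proof. by case: (subgroupP H). Qed.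
Lemma subgM_subproof (x y : subg) : (H : set G) (subg_val x * subg_val y)%g.
Proof. by case: (subgroupP H) => _ + _; apply; exact: subg_valP. Qed.
Lemma subgV_subproof (x : subg) : (H : set G) (subg_val x)^-1%g.
Proof. by case: (subgroupP H) => _ _; apply; exact: subg_valP. Qed.

Definition subg_one : subg := Subg subg1_subproof.
Definition subg_mul (x y : subg) : subg := Subg (subgM_subproof x y).
Definition subg_inv (x : subg) : subg := Subg (subgV_subproof x).

Lemma subg_mulA : associative subg_mul.
Proof. by move=> x y z; apply: subg_val_inj; exact: mulgA. Qed.
Lemma subg_mul1l : left_id subg_one subg_mul.
Proof. by move=> x; apply: subg_val_inj; exact: mul1g. Qed.
Lemma subg_mul1 : right_id subg_one subg_mul.
Proof. by move=> x; apply: subg_val_inj; exact: mulg1. Qed.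
Lemma subg_mulVl : left_inverse subg_one subg_inv subg_mul.
Proof. by move=> x; apply: subg_val_inj; exact: mulVg. Qed.
Lemma subg_mulV : right_inverse subg_one subg_inv subg_mul.
Proof. by move=> x; apply: subg_val_inj; exact: mulgV. Qed.

HB.instance Definition _ := isGroup.Build subg
  subg_mulA subg_mul1l subg_mul1 subg_mulVl subg_mulV.
End subgroup_type.

Definition kernel (G H : groupType) (f : G -> H) : set G := [set x | f x = 1%g].

(* The groups are carried by subsets of magmas, so as to cover both subgroups
   and quotients. *)
Definition isog (G H : magmaType) (A : set G) (B : set H) : Prop :=
  exists2 f : G -> H, set_bij A B f &
    forall x y, A x -> A y -> f (x * y)%g = (f x * f y)%g.

(* An extension by Q of N. *)
Definition is_extension (G Q : groupType) (E N : set G) : Prop :=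
  normal N E /\ isog (quotient E N) [set: Q].

Lemma morphism_image_subgroup (G H : groupType) (f : G -> H) :
  {morph f : x y / (x * y)%g} -> is_subgroup (range f).
Proof.
move=> fM; have f1 : f 1%g = 1%g by apply: (@mulgI _ (f 1%g)); rewrite -fM !mulg1.
split=> [|_ _ [x _ <-] [y _ <-]|_ [x _ <-]].
- by exists 1%g.
- by exists (x * y)%g.
- exists x^-1%g => //; apply: (@mulgI _ (f x)).
  by rewrite -fM !mulgV.
Qed.

Section wreath.
Context (E : Type) (P : groupType) (M : subgroup (Sym E)).

Definition fun_act (f : E -> P) (t : Sym E) : E -> P := fun e => f (t^-1%g e).

Record wreath : Type := Wreath { wreath_fun : E -> P; wreath_proj : subg M }.

HB.instance Definition _ := gen_eqMixin wreath.
HB.instance Definition _ := gen_choiceMixin wreath.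

Definition wreath_one : wreath := Wreath (fun=> 1%g) 1%g.
Definition wreath_mul (u v : wreath) : wreath :=
  Wreath (fun e => wreath_fun u e *
            fun_act (wreath_fun v) (subg_val (wreath_proj u))^-1 e)%g
         (wreath_proj u * wreath_proj v)%g.
Definition wreath_inv (u : wreath) : wreath :=
  Wreath (fun e => (fun_act (wreath_fun u) (subg_val (wreath_proj u)) e)^-1)%g
         (wreath_proj u)^-1%g.

Lemma wreath_mulA : associative wreath_mul.
Proof.
move=> [f s] [g t] [h u]; rewrite /wreath_mul /= mulgA; congr Wreath.
by apply/funext => e; rewrite mulgA.
Qed.
Lemma wreath_mul1l : left_id wreath_one wreath_mul.
Proof.
move=> [f s]; rewrite /wreath_mul /= mul1g; congr Wreath.
by apply/funext => e; rewrite mul1g.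
Qed.
Lemma wreath_mul1 : right_id wreath_one wreath_mul.
Proof.
move=> [f s]; rewrite /wreath_mul /= mulg1; congr Wreath.
by apply/funext => e; rewrite /fun_act mulg1.
Qed.
Lemma wreath_mulVl : left_inverse wreath_one wreath_inv wreath_mul.
Proof.
move=> [f s]; rewrite /wreath_mul /= mulVg; congr Wreath.
by apply/funext => e; exact: mulVg.
Qed.
Lemma wreath_mulV : right_inverse wreath_one wreath_inv wreath_mul.
Proof.
move=> [f s]; rewrite /wreath_mul /= mulgV; congr Wreath.
apply/funext => e; rewrite /fun_act /= symK; exact: mulgV.
Qed.

HB.instance Definition _ := isGroup.Build wreath
  wreath_mulA wreath_mul1l wreath_mul1 wreath_mulVl wreath_mulV.
End wreath.

Definition P1 (R : realType) : topologicalType := one_point_compactification R[i]^o.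

Section sphere.
Context (R : realType).
Local Notation C := (R[i]^o).

Definition pt (z : R[i]) : P1 R := Some z.
Definition infty : P1 R := None.

Definition special : set (P1 R) := [set pt 0; pt 1; infty].
Definition Pstar : topologicalType := set_type (~` special).
Definition pstar_val (x : Pstar) : P1 R := \val x.

Definition mkPstar (a : P1 R) (aP : a \in ~` special) : Pstar :=
  @exist (P1 R) (fun a => a \in ~` special) a aP.

Lemma PstarP z : z != 0 -> z != 1 -> pt z \in ~` special.
Proof.
move=> z0 z1; apply/mem_set => -[[[]|[]]|//]; exact/eqP.
Qed.

Definition inv_P1 (a : P1 R) : P1 R :=
  if a is Some z then (if z == 0 then infty else pt z^-1) else pt 0.

(* The holomorphic chart centred at a: h |-> a + h when a is finite, and
   h |-> 1 / h when a is infinite. *)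
Definition chart (a : P1 R) (h : R[i]) : P1 R :=
  if a is Some z then pt (z + h) else inv_P1 (pt h).

(* c is the sequence of Taylor coefficients of beta at a, in the charts centred
   at a and at beta a. *)
Definition taylor (beta : P1 R -> P1 R) (a : P1 R) (c : nat -> R[i]) : Prop :=
  exists2 r : R, 0 < r & forall h : R[i], `|h| < r%:C ->
    exists2 w : R[i],
      (series (fun k => c k * h ^+ k : C) @ \oo --> (w : C)) &
      beta (chart a h) = chart (beta a) w.

(* Holomorphic as a map to the sphere, and not identically infinite. *)
Definition meromorphic (beta : P1 R -> P1 R) : Prop :=
  (forall a, exists c, taylor beta a c) /\ exists a, beta a <> infty.

(* The local multiplicity at a, the least k > 0 with c_k nonzero, is 1. *)
Definition unbranched_at (beta : P1 R -> P1 R) (a : P1 R) : Prop :=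
  exists2 c, taylor beta a c & c 1%N != 0.

Definition belyi (beta : P1 R -> P1 R) : Prop :=
  meromorphic beta /\ forall a, ~ special (beta a) -> unbranched_at beta a.

Definition dynamical_belyi (beta : P1 R -> P1 R) : Prop :=
  belyi beta /\ beta @` special `<=` special.

End sphere.

Section base_paths.
Context (R : realType).
Local Notation C := (R[i]^o).
Local Notation I := (I01 R).

Lemma real_complex_continuous : continuous (fun x : R => x%:C : C).
Proof.
move=> x; apply/cvgrPdist_lt => e; rewrite ltcE /= => /andP[/eqP e0 e1].
have : \forall t \near x, `|x - t| < complex.Re e.
  by move: (@cvg_id _ (nbhs x)) => /cvgrPdist_lt; exact.
apply: filterS => t; rewrite -rmorphB normc_def /= expr0n addr0 sqrtr_sqr.
by rewrite ltcE /= e0 eqxx.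
Qed.

Lemma continuous_Complex (T : topologicalType) (f g : T -> R) :
  continuous f -> continuous g -> continuous (fun t => f t +i* g t : C).
Proof.
move=> cf cg t.
have -> : (fun t => f t +i* g t) = (fun t => (f t)%:C + (0 +i* 1) * (g t)%:C).
  apply/funext => u; apply/eqP; rewrite eq_complex /=.
  by apply/andP; split; apply/eqP; ring.
apply: (@cvgD _ C _ _ _ (fun t => (f t)%:C) (fun t => (0 +i* 1) * (g t)%:C)).
  by apply: (continuous_funcomp (h := fun x : R => x%:C : C)) => //;
    exact: real_complex_continuous.
apply: (@cvgM C _ _ _ (fun=> 0 +i* 1) (fun t => (g t)%:C)); first exact: cvg_cst.
by apply: (continuous_funcomp (h := fun x : R => x%:C : C)) => //;
  exact: real_complex_continuous.
Qed.

Lemma base_pt_subproof : pt (2^-1)%:C \in ~` (@special R).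
Proof.
by apply: PstarP; rewrite eq_complex /= eqxx andbT; apply/eqP; lra.
Qed.

Definition base_pt : Pstar R := mkPstar base_pt_subproof.

Definition segment (z : R[i]) (t : R) : R[i] := (1 - t)%:C * z + (t / 2)%:C.

(* m + r e^(i theta) with m = (x + 1/2) / 2 and r = (x - 1/2) / 2, for theta
   going from 0 to pi when r > 0 and from 0 to - pi when r < 0. *)
Definition semicircle (x t : R) : R[i] :=
  ((x + 2^-1) / 2 + (x - 2^-1) / 2 * cos (pi * t))
  +i* (`|x - 2^-1| / 2 * sin (pi * t)).

Definition to_half (z : R[i]) (t : R) : R[i] :=
  if (complex.Im z == 0) && ((complex.Re z < 0) || (1 < complex.Re z))
  then semicircle (complex.Re z) t else segment z t.

Lemma to_half0 z : to_half z 0 = z.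
Proof.
apply/eqP; rewrite /to_half eq_complex; case: ifP => [/andP[/eqP z0 _]|_] /=.
  rewrite mulr0 cos0 sin0 z0 mulr0 eqxx andbT; apply/eqP; lra.
by case: z => x y /=; apply/andP; split; apply/eqP; lra.
Qed.

Lemma to_half1 z : to_half z 1 = (2^-1)%:C.
Proof.
apply/eqP; rewrite /to_half eq_complex; case: ifP => _ /=.
  rewrite mulr1 cospi sinpi mulr0 eqxx andbT; apply/eqP; lra.
by case: z => x y /=; apply/andP; split; apply/eqP; lra.
Qed.

Lemma to_half_subproof z t : pt z \in ~` (@special R) -> 0 <= t <= 1 ->
  pt (to_half z t) \in ~` (@special R).
Proof.
move=> /set_mem zP /andP[t0 t1].
have z0 : z != 0 by apply/eqP => z0; apply: zP; left; left; rewrite z0.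
have z1 : z != 1 by apply/eqP => z1; apply: zP; left; right; rewrite z1.
have [te0|tn0] := eqVneq t 0; first by rewrite te0 to_half0; exact: PstarP.
have [te1|tn1] := eqVneq t 1; first by rewrite te1 to_half1; exact: base_pt_subproof.
have {}t0 : 0 < t by rewrite lt_def tn0.
have {}t1 : t < 1 by rewrite lt_def eq_sym tn1.
suff [H|[H0 H1]] : complex.Im (to_half z t) != 0 \/
    0 < complex.Re (to_half z t) /\ complex.Re (to_half z t) < 1.
- by apply: PstarP; apply: contra_neq H => ->.
- by apply: PstarP; [apply: contraTneq H0 | apply: contraTneq H1] => -> /=;
    rewrite ltxx.
rewrite /to_half; case: ifP => [/andP[/eqP zr zout]|zin].
  left => /=; rewrite mulf_neq0 //; last first.
    apply: lt0r_neq0; apply: sin_gt0_pi; have := pi_gt0 R; nra.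
  rewrite mulf_neq0 ?invr_eq0 ?pnatr_eq0 // normr_eq0 subr_eq0.
  by case/orP: zout => ?; apply/eqP; lra.
have [zr|zr] := eqVneq (complex.Im z) 0; last first.
  left; case: z zr {zP z0 z1 zin} => x y /= zr.
  rewrite (_ : _ + _ = (1 - t) * y); last by ring.
  by rewrite mulf_neq0 // subr_eq0 eq_sym.
right; move: zin z0 z1; rewrite zr eqxx /=.
move: zr; case: z {zP} => x y /= ->; rewrite !eq_complex /= eqxx !andbT.
move=> /norP[]; rewrite -!leNgt => x0 x1 xn0 xn1.
have {}x0 : 0 < x by rewrite lt_def xn0.
have {}x1 : x < 1 by rewrite lt_def eq_sym xn1.
by split; nra.
Qed.

Lemma to_half_continuous z : continuous (fun t : I => to_half z (ival t) : C).
Proof.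
have c := @ival_continuous R.
rewrite /to_half; case: (_ && _).
  apply: continuous_Complex.
    apply: continuous_addf; first by continuity.
    apply: continuous_mulf; first by continuity.
    apply: (continuous_funcomp (k := fun t : I => pi * ival t) (h := @cos R)).
      by continuity.
    exact: continuous_cos.
  apply: continuous_mulf; first by continuity.
  apply: (continuous_funcomp (k := fun t : I => pi * ival t) (h := @sin R)).
    by continuity.
  exact: continuous_sin.
rewrite (_ : (fun t => _) = fun t : I =>
    ((1 - ival t) * complex.Re z + ival t / 2) +i* ((1 - ival t) * complex.Im z)).
  by apply: continuous_Complex; continuity.
apply/funext => t; apply/eqP; rewrite eq_complex; case: z => x y /=.
by apply/andP; split; apply/eqP; ring.
Qed.

Section path_to_half.
Variable x : Pstar R.

(* Junk value 0 at infinity, which is not a point of Pstar. *)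
Definition coordinate (a : P1 R) : R[i] := if a is Some z then z else 0.

Lemma coordinateK (y : Pstar R) : pt (coordinate (pstar_val y)) = pstar_val y.
Proof.
rewrite /pstar_val; case: y => -[z|] yP //=.
by case: (set_mem yP); right.
Qed.

Lemma path_to_half_subproof (t : I) :
  pt (to_half (coordinate (pstar_val x)) (ival t)) \in ~` (@special R).
Proof.
apply: to_half_subproof; last by rewrite ival_ge0 ival_le1.
by rewrite coordinateK; exact: (valP x).
Qed.

Definition path_to_half (t : I) : Pstar R := mkPstar (path_to_half_subproof t).

Lemma path_to_half_continuous : continuous path_to_half.
Proof.
apply: (@continuous_comp_initial _ I (P1 R) (@pstar_val R) path_to_half).
apply: (@continuous_funcomp I C (P1 R)
  (fun t : I => to_half (coordinate (pstar_val x)) (ival t)) (@pt R)).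
  exact: to_half_continuous.
exact: one_point_compactification_some_continuous.
Qed.

Lemma path_to_half_zero : path_to_half zero = x.
Proof.
apply: val_inj; rewrite /= -/(pstar_val x) -[RHS]coordinateK.
by congr pt; rewrite [ival _]ival0 to_half0.
Qed.

Lemma path_to_half_one : path_to_half one = base_pt.
Proof. by apply: val_inj; rewrite /= [ival _]ival1 to_half1. Qed.

HB.instance Definition _ :=
  isContinuous.Build I (Pstar R) path_to_half path_to_half_continuous.
HB.instance Definition _ :=
  isPath.Build I (Pstar R) x base_pt path_to_half path_to_half_zero path_to_half_one.
End path_to_half.

Definition based_loop (p : continuousType I (Pstar R)) :
    {path I from base_pt to base_pt in Pstar R} :=
  conc_path (rev_path (path_to_half (p zero)))
    (conc_path (mk_path (@cts_fun _ _ p) erefl erefl) (path_to_half (p one))).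
End base_paths.

Section monodromy.
Context (R : realType) (beta : P1 R -> P1 R).
Local Notation I := (I01 R).

Definition pi1_star : groupType := pi1 R (base_pt R).

(* The values lie in the preimage of [0, 1] by edgeP. *)
Record edge : Type := Edge {
  edge_fun :> I -> P1 R;
  edge_continuous : continuous edge_fun;
  edgeP : forall t : I, beta (edge_fun t) = pt (ival t)%:C }.

HB.instance Definition _ := gen_eqMixin edge.
HB.instance Definition _ := gen_choiceMixin edge.

Definition edge_mid (e : edge) : P1 R := e (clamp 2^-1).

(* q is a lift of p by beta starting at y. Since beta maps special points to
   special points, a lift of a path of Pstar necessarily runs in Pstar. *)
Definition is_lift (p : I -> Pstar R) (y : P1 R) (q : I -> Pstar R) : Prop :=
  pstar_val (q zero) = y /\
  forall t, beta (pstar_val (q t)) = pstar_val (p t).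

Definition path_lift (p : I -> Pstar R) (y : P1 R) : continuousType I (Pstar R) :=
  xget (cst (base_pt R) : continuousType I (Pstar R))
    [set q : continuousType I (Pstar R) | is_lift p y q].

(* The lift of a representative of l; neither the endpoint of the lift nor its
   homotopy class depends on the representative. *)
Definition lift_at (l : pi1_star) (e : edge) : continuousType I (Pstar R) :=
  path_lift (repr l) (edge_mid e).

Definition edge_act (l : pi1_star) (e : edge) : edge :=
  xget e [set e' : edge | exists t, e' t = pstar_val (lift_at l e one)].

Definition rho (l : pi1_star) : Sym edge := sym_of (edge_act l).

(* Since rho is a morphism its range is already a subgroup (see generated_id and
   morphism_image_subgroup); generating makes it one by construction. *)
Definition Mon : subgroup (Sym edge) := generated (range rho).

Lemma Mon_rho (l : pi1_star) : (Mon : set (Sym edge)) (rho l).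
Proof. by apply: sub_generated; exists l. Qed.

Definition tau (l : pi1_star) : subg Mon := Subg (Mon_rho l).

Definition extending_pattern (l : pi1_star) (e : edge) : pi1_star :=
  pi1_class (based_loop (lift_at l e)).

Definition phi (l : pi1_star) : wreath pi1_star Mon :=
  Wreath (extending_pattern l) (tau l).
End monodromy.

(* Main.v *)
Require Import Defs.
From mathcomp Require Import all_boot all_order all_algebra.
From mathcomp Require Import ring lra.
From mathcomp Require Import all_classical all_reals.
From mathcomp Require Import topology normedtype sequences homotopy.
From mathcomp Require Import derive complex.

Set Implicit Arguments.
Unset Strict Implicit.
Unset Printing Implicit Defensive.

Import Order.TTheory GRing.Theory Num.Theory numFieldNormedType.Exports.

Local Open Scope classical_set_scope.
Local Open Scope ring_scope.

(* beta is a finite covering over the complement of 0, 1, infinity, so loops and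
   homotopies lift uniquely. The segment from 1/2 to t in (0, 1) lifts from any
   point over 1/2, which gives the edge through that point; its ends exist since
   fibres over 0 and 1 are discrete along it. The lift of l1 * l2 at e is the
   lift of l1 at e followed by the lift of l2 at e^l1, and closing up paths is
   multiplicative up to homotopy, so phi is a morphism; the rest is the first
   isomorphism theorem. *)

(** * Local sections, evenly covered points, uniqueness of lifts *)

Section coverings.
Context (Y Z : topologicalType) (f : Y -> Z).

(** The hypothesis on [beta] is a convergent Taylor expansion at each point, so the covering
    property has to come from estimates on power series. A nonzero linear coefficient makes [beta] a
    small Lipschitz perturbation of a linear map in the charts, hence locally invertible;
    compactness of the sphere then turns local sections into an evenly covered neighbourhood. The
    delicate place is the ends of edges: [beta] may branch over 0 and 1, so lifting stops there and
    each end is found as a limit, using that near any point [beta] is either constant or takes its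
    value there only once. The dynamical condition keeps lifts inside [Pstar], so that closing them
    up gives elements of the same kind of group. Lifts, edges and permutations are selected by
    choice with default values; each needs existence, to exclude the default, and uniqueness, to
    compute with it. *)

Definition sheet (V : set Z) (s : Z -> Y) : Prop :=
  forall v, V v -> [/\ {for v, continuous s}, f (s v) = v &
    \forall y \near s v, s (f y) = y].

Definition etale_at (y : Y) : Prop :=
  exists V s, [/\ open V, V (f y), s (f y) = y & sheet V s].

(** The decomposition of the preimage of [V] into disjoint copies is encoded by one section through
    each point above [V]. Each section is inverse to [f] on both sides locally, so it plays the role
    of a sheet. *)
Definition evenly_covered (z : Z) : Prop :=
  exists V, [/\ open V, V z &
    forall y, V (f y) -> exists2 s, sheet V s & s (f y) = y].

Lemma evenly_covered_etale y : evenly_covered (f y) -> etale_at y.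
Proof. by move=> [V [oV Vy /(_ _ Vy)[s Vs sy]]]; exists V, s. Qed.

Lemma sheet_sub V W s : V `<=` W -> sheet W s -> sheet V s.
Proof. by move=> VW Ws v /VW/Ws. Qed.

(** The Hausdorff property keeps points off the fibre of [z] away from it, and points on it carry a
    local section; compactness of [Y] finds one [V] that serves all points at once. *)
Lemma etale_evenly_covered z : compact [set: Y] -> hausdorff_space Z ->
  continuous f -> (forall y, f y = z -> etale_at y) -> evenly_covered z.
Proof.
move=> cY hZ cf ez.
(* Quantifying over open subsets [W] makes the property pass to smaller [V]. *)
pose P (V : set Z) (y : Y) := forall W, open W -> W `<=` V -> W (f y) ->
  exists2 s, sheet W s & s (f y) = y.
have : \forall V \near powerset_filter_from (nbhs z), [set: Y] `<=` P V.
  move/compact_near_coveringP : cY; apply => y _.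
  have [fyz|fyz] := pselect (f y = z); last first.
    have [[A B] /= [Afy Bz] [oA oB AB]] : exists2 AB : set Z * set Z,
        f y \in AB.1 /\ z \in AB.2 & [/\ open AB.1, open AB.2 & AB.1 `&` AB.2 == set0].
      by move: hZ; rewrite open_hausdorff => /(_ (f y) z); apply; apply/eqP.
    have nA : \forall y' \near y, A (f y').
      by apply: cf; apply: open_nbhs_nbhs; split => //; exact: set_mem.
    have nB : nbhs z B by apply: open_nbhs_nbhs; split => //; exact: set_mem.
    near=> y' V => W oW WV Wy'.
    have : (A `&` B) (f y').
      split; first by near: y'.
      by apply: (near (small_set_sub nB) V) => //; exact: WV.
    by rewrite (eqP AB).
  have [V0 [s [oV0 V0y sy sV0]]] := ez _ fyz.
  have [_ _ nsy] := sV0 _ V0y.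
  rewrite sy in nsy.
  have nV0 : nbhs z V0 by rewrite -fyz; apply: open_nbhs_nbhs.
  near=> y' V.
  have Ey : s (f y') = y' by near: y'.
  have VV0 : V `<=` V0 by near: V; exact: small_set_sub.
  by move=> W oW WV Wy'; exists s => //; apply: sheet_sub sV0; exact: subset_trans VV0.
move=> /near_powerset_filter_fromP[A B AB PB y Ty W oW WA|V nV PV].
  by apply: (PB y Ty) => //; exact: subset_trans AB.
exists V^°; split; first exact: open_interior.
  exact: nV.
move=> y Vy; apply: (PV y I) => //; [exact: open_interior|exact: interior_subset].
Unshelve. all: by end_near. Qed.

(** Both [P] and its negation are relatively open in [A]. *)
Lemma connected_ind (T : topologicalType) (A : set T) (P : T -> Prop) :
  connected A ->
  (forall t, A t -> \forall u \near t, A u -> (P u <-> P t)) ->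
  forall s t, A s -> A t -> P s -> P t.
Proof.
move=> cA AP s t As At Ps.
have oQ (Q : T -> Prop) : (forall t, A t -> \forall u \near t, A u -> (Q u <-> Q t)) ->
    exists2 C, open C & A `&` Q = A `&` C.
  move=> AQ; exists [set u | A u -> Q u]^°; first exact: open_interior.
  apply/seteqP; split => u [Au Qu]; split => //.
    by have := AQ _ Au; apply: filterS => v Hv Av; apply/Hv.
  by have := interior_subset Qu; exact.
suff E : A `&` P = A by move: At; rewrite -{1}E => -[].
apply: cA; first by exists s.
  exact: oQ.
have [|C oC E] := oQ (fun u => ~ P u).
  by move=> u Au; have := AP _ Au; apply: filterS => v Hv Av; rewrite Hv.
exists (~` C); first exact: open_closedC.
apply/seteqP; split => u [Au Pu]; split => //.
  move=> Cu; have : (A `&` C) u by []; rewrite -E; by case.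
apply: contrapT => nPu; apply: Pu.
by have : (A `&` (fun u => ~ P u)) u by []; rewrite E => -[].
Qed.

(** Where the two maps agree, both are recovered nearby from their common image through one local
    section; where they differ, the Hausdorff property keeps them apart. Agreement is thus locally
    constant. *)
Lemma lift_unique (T : topologicalType) (A : set T) (g h : T -> Y) t0 :
  hausdorff_space Y -> connected A ->
  (forall t, A t -> {for t, continuous g}) ->
  (forall t, A t -> {for t, continuous h}) ->
  (forall t, A t -> f (g t) = f (h t)) ->
  (forall t, A t -> etale_at (g t)) ->
  A t0 -> g t0 = h t0 -> forall t, A t -> g t = h t.
Proof.
move=> hY cA cg ch gh eg At0 E0 t At.
apply: (connected_ind cA (P := fun t => g t = h t)) At0 At E0 => {}t At.
have [E|NE] := pselect (g t = h t).
  have [V [s [oV Vs sg sV]]] := eg _ At.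
  have [_ _] := sV _ Vs; rewrite sg => ns.
  have ng : \forall u \near t, s (f (g u)) = g u := cg _ At _ ns.
  have nh : \forall u \near t, s (f (h u)) = h u.
    by rewrite E in ns; exact: (ch _ At _ ns).
  near=> u => Au; split=> // _.
  have <- : s (f (g u)) = g u by near: u.
  by rewrite gh //; near: u.
have [[B C] /= [Bg Ch] [oB oC BC]] : exists2 AB : set Y * set Y,
    g t \in AB.1 /\ h t \in AB.2 & [/\ open AB.1, open AB.2 & AB.1 `&` AB.2 == set0].
  by move: hY; rewrite open_hausdorff => /(_ (g t) (h t)); apply; apply/eqP.
have ng : \forall u \near t, B (g u).
  by apply: (cg _ At B); apply: open_nbhs_nbhs; split => //; exact: set_mem.
have nh : \forall u \near t, C (h u).
  by apply: (ch _ At C); apply: open_nbhs_nbhs; split => //; exact: set_mem.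
near=> u => Au; split=> // Eu; exfalso.
suff : (B `&` C) (g u) by rewrite (eqP BC).
by split; [near: u | rewrite Eu; near: u].
Unshelve. all: by end_near. Qed.

End coverings.

(** * Topology of the unit interval *)

Section interval_topology.
Context (R : realType).
Local Notation I := (I01 R).

Lemma I01_nbhsP (t : I) (N : set I) :
  nbhs t N -> exists2 e : R, 0 < e & forall u, `|ival u - ival t| < e -> N u.
Proof.
move=> [_ [[W oW <-] /= Wt WN]].
have : nbhs (ival t) W by apply: open_nbhs_nbhs.
move=> /nbhs_ballP[e e0 eW]; exists e => // u ute.
by apply: WN; apply: eW; rewrite /ball /= distrC.
Qed.

Lemma I01_near (t : I) (e : R) : 0 < e -> \forall u \near t, `|ival u - ival t| < e.
Proof.
move=> e0; have /cvgrPdist_lt/(_ e e0) := @ival_continuous R t.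
by apply: filterS => u; rewrite distrC.
Qed.

Lemma I01_ball_connected (a e : R) : connected [set u : I | `|ival u - a| < e].
Proof.
rewrite (_ : [set u | _] = @clamp R @` (`[0, 1] `&` `]a - e, a + e[)%classic).
  apply: connected_continuous_connected; last first.
    by apply: continuous_subspaceT => x; exact: clamp_continuous.
  apply/connected_intervalP => x y [+ +] [+ +] z /andP[xz zy] /=.
  by rewrite /= !in_itv /= => *; split; lra.
apply/seteqP; split => [u /= ua|_ [x [+ +] <-]] /=.
  exists (ival u); last exact: ivalK.
  have := ival_ge0 u; have := ival_le1 u; rewrite !in_itv /=.
  by move: ua; rewrite ltr_distl => *; split; lra.
by rewrite /= !in_itv /= => x01 xa; rewrite clampK // ltr_distl; lra.
Qed.

Lemma I01_connected : connected [set: I].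
Proof.
rewrite (_ : setT = [set u : I | `|ival u - 0| < 2]); first exact: I01_ball_connected.
apply/seteqP; split => // u _ /=; have := ival_ge0 u; have := ival_le1 u.
by rewrite ltr_distl; lra.
Qed.

End interval_topology.

(** * Lifting of paths and of families of paths *)

Section lifting.
Context (R : realType) (Y Z : topologicalType) (f : Y -> Z).
Hypotheses (cf : continuous f) (hY : hausdorff_space Y).
Local Notation I := (I01 R).

(** The lifts [L s] may be chosen independently for each [s]; unique lifting forces them to vary
    continuously. It serves both the construction of edges and the lifting of homotopies. *)
Lemma lift_jointly_continuous (S : topologicalType) (K : S * I -> Z)
    (L : S -> I -> Y) (s0 : S) :
  (forall t, {for (s0, t), continuous K}) ->
  (\forall s \near s0, continuous (L s)) ->
  (\forall s \near s0, forall t, f (L s t) = K (s, t)) ->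
  (forall t, evenly_covered f (K (s0, t))) ->
  {for s0, continuous (fun s => L s zero)} ->
  forall t, {for (s0, t), continuous (fun u => L u.1 u.2)}.
Proof.
move=> cK cL fL eK cL0.
(* B holds at all or at none of the points near any t, since there L is a
   section composed with K as soon as it is so at one point; I is connected. *)
pose B (t : I) := {for s0, continuous (fun s => L s t)}.
have loc t0 : exists e W (V : set Z) , [/\ 0 < e, nbhs s0 W, open V,
     (forall s t, W s -> `|ival t - ival t0| < e -> V (K (s, t)))
   & forall y, V (f y) -> exists2 s, sheet f V s & s (f y) = y].
  have [V [oV V0 Vs]] := eK t0.
  have : nbhs (s0, t0) (K @^-1` V) by apply: cK; apply: open_nbhs_nbhs.
  move=> [[W N] /= [Ws Nt] WN]; have [e e0 eN] := I01_nbhsP Nt.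
  exists e, W, V; split => // s t Wss te; apply: (WN (s, t)); split => //.
  exact: eN.
have fs0 : forall t, f (L s0 t) = K (s0, t) by exact: nbhs_singleton fL.
have main t0 t1 e W V : 0 < e -> nbhs s0 W -> open V ->
    (forall s t, W s -> `|ival t - ival t0| < e -> V (K (s, t))) ->
    (forall y, V (f y) -> exists2 s, sheet f V s & s (f y) = y) ->
    `|ival t1 - ival t0| < e -> B t1 ->
    forall t, `|ival t - ival t0| < e -> {for (s0, t), continuous (fun u => L u.1 u.2)}.
  move=> e0 Ws oV WV Vs t1e Bt1 t te.
  have Ws0 : W s0 := nbhs_singleton Ws.
  have V1 : V (f (L s0 t1)) by rewrite fs0; exact: WV.
  have [s sV sL] := Vs _ V1.
  have [_ _] := sV _ V1; rewrite sL => ns.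
  have Lt1 : \forall r \near s0, s (f (L r t1)) = L r t1 := Bt1 _ ns.
  have E : \forall r \near s0, forall u, `|ival u - ival t0| < e ->
      L r u = s (K (r, u)).
    near=> r.
    have cLr : continuous (L r) by near: r.
    have fLr : forall u, f (L r u) = K (r, u) by near: r.
    have sLr : s (f (L r t1)) = L r t1 by near: r.
    have Wr : W r by near: r.
    have VL u : `|ival u - ival t0| < e -> V (f (L r u)).
      by rewrite fLr => ?; exact: WV.
    move=> u ue; rewrite -fLr.
    apply: (lift_unique (f := f) (A := [set u : I | `|ival u - ival t0| < e])
       (g := L r) (h := fun u => s (f (L r u))) (t0 := t1)) => //.
    - exact: I01_ball_connected.
    - by move=> v _; exact: cLr.
    - move=> v /= ve; have [cs _ _] := sV _ (VL _ ve).
      apply: (@continuous_comp _ _ _ (fun u => f (L r u)) s) => //.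
      by apply: (@continuous_comp _ _ _ (L r) f); [exact: cLr | exact: cf].
    - by move=> v /= ve; have [_ -> _] := sV _ (VL _ ve).
    - move=> v /= ve; apply: evenly_covered_etale; exists V; split => //; exact: VL.
  have cvK : {for (s0, t), continuous (s \o K)}.
    apply: continuous_comp; first exact: cK.
    by have [] := sV _ (WV s0 t Ws0 te).
  have Et : L s0 t = s (K (s0, t)) by exact: (nbhs_singleton E).
  rewrite /prop_for /continuous_at /= Et.
  apply: cvg_trans cvK; apply: near_eq_cvg.
  have nt : \forall u \near t, `|ival u - ival t0| < e.
    have d0 : 0 < e - `|ival t - ival t0| by lra.
    have := I01_near t d0; apply: filterS => u ud.
    by have := ler_distD (ival t) (ival u) (ival t0); lra.
  exists ([set r | forall u, `|ival u - ival t0| < e -> L r u = s (K (r, u))],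
    [set u | `|ival u - ival t0| < e]); first by split.
  by move=> [r u] /= [rE ue]; rewrite rE.
have slice t : {for (s0, t), continuous (fun u => L u.1 u.2)} -> B t.
  move=> H; apply: (@continuous_comp _ _ _ (fun s => (s, t)) (fun u => L u.1 u.2)) => //.
  apply: continuous_pairf; last exact: continuous_cstf.
  by move=> s; exact: cvg_id.
have BT : forall t, B t.
  suff step : forall t, [set: I] t -> \forall u \near t, [set: I] u -> (B u <-> B t).
    by move=> t; exact: (connected_ind (@I01_connected R) step (s := zero) Logic.I Logic.I cL0).
  move=> t _.
  have [e [W [V [e0 Ws oV WV Vs]]]] := loc t.
  have te : `|ival t - ival t| < e by rewrite subrr normr0.
  have := I01_near t e0; apply: filterS => u ue _; split => Bu; apply: slice.
    by apply: (main t u e W V).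
  by apply: (main t t e W V).
move=> t; have [e [W [V [e0 Ws oV WV Vs]]]] := loc t.
by apply: (main t t e W V) => //; rewrite subrr normr0.
Unshelve. all: by end_near. Qed.

(** Instead of subdividing the interval, the existence of a lift up to time [r] is shown to be
    locally constant in [r]. *)
Lemma path_lift_exists (p : I -> Z) (y : Y) : continuous p -> f y = p zero ->
  (forall t, evenly_covered f (p t)) ->
  exists q : I -> Y, [/\ continuous q, q zero = y & forall t, f (q t) = p t].
Proof.
move=> cp fy ep.
(* Freezing the path at time [r] lets a partial lift be a function on all of [I]. *)
pose stop (r : R) (t : I) : I := clamp (Num.min (ival t) r).
have cstop r : continuous (stop r) by rewrite /stop; continuity.
pose B (r : I) := exists q : I -> Y, [/\ continuous q, q zero = y &
  forall t, f (q t) = p (stop (ival r) t)].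
suff [q [cq q0 fq]] : B one.
  exists q; split => // t; rewrite fq /stop ival1 min_l ?ivalK //; exact: ival_le1.
have B0 : B zero.
  exists (cst y); split => // [|t]; first exact: continuous_cstf.
  by rewrite fy /stop ival0 min_r //; exact: ival_ge0.
suff step : forall t, [set: I] t -> \forall u \near t, [set: I] u -> (B u <-> B t).
  exact: (connected_ind (@I01_connected R) step (s := zero) Logic.I Logic.I B0).
move=> t _.
have [V [oV V0 Vs]] := ep t.
have : nbhs t (p @^-1` V) by apply: cp; apply: open_nbhs_nbhs.
move=> /I01_nbhsP[e e0 eN].
have main (t1 t2 : I) : `|ival t1 - ival t| < e -> `|ival t2 - ival t| < e -> B t1 -> B t2.
  move=> t1e t2e [q [cq q0 fq]].
  have [t21|t12] := leP (ival t2) (ival t1).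
    exists (fun u => q (stop (ival t2) u)); split => [||u].
    - exact: continuous_funcomp.
    - rewrite -[in RHS]q0; congr q; rewrite /stop ival0 min_l //; exact: ival_ge0.
    - have h : 0 <= Num.min (ival u) (ival t2) <= 1.
        by rewrite le_min ge_min !ival_ge0 ival_le1.
      rewrite fq /stop; congr (p (clamp _)).
      by rewrite [ival _](clampK h) min_l // ge_min t21 orbT.
  have Ep1 : f (q t1) = p t1 by rewrite fq /stop min_l ?ivalK.
  have V1 : V (f (q t1)) by rewrite Ep1; exact: eN.
  have [s sV sq] := Vs _ V1.
  (* [m] keeps the parameter between [t1] and [t2], where [p] stays in [V], so the continuation by
     [s] is continuous on all of [I] and can be glued. *)
  pose m (u : I) : I := clamp (Num.max (ival t1) (Num.min (ival u) (ival t2))).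
  have cm : continuous m by rewrite /m; continuity.
  have ivm u : ival (m u) = Num.max (ival t1) (Num.min (ival u) (ival t2)).
    by rewrite clampK // le_max ival_ge0 ge_max ge_min ?ival_le1.
  have Vm u : V (p (m u)).
    apply: eN; move: t1e t2e; rewrite ivm !ltr_distl.
    move=> /andP[? ?] /andP[? ?].
    by case: (leP (ival u) (ival t2)) => ?; case: (leP (ival t1) _) => ?; apply/andP; split; lra.
  have stop1 u : stop (ival t1) u = u \/ stop (ival t1) u = t1.
    by rewrite /stop; case: (leP (ival u) _) => _; rewrite ivalK; [left|right].
  exists (fun u => if ival u - ival t1 <= 0 then q u else s (p (m u))); split => [||u].
  - apply: (glue_continuous (g := fun u : I => ival u - ival t1)) => //.
    + by continuity.
    + move=> u; have [cs _ _] := sV _ (Vm u).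
      apply: (@continuous_comp _ _ _ (fun u => p (m u)) s) => //.
      by apply: (@continuous_comp _ _ _ m p); [exact: cm | exact: cp].
    + move=> u /eqP; rewrite subr_eq0 => /eqP/ival_inj ->.
      rewrite -sq Ep1; congr (s (p _)); apply: ival_inj; rewrite ivm.
      by rewrite min_l ?maxxx // ltW.
  - by rewrite ival0 sub0r oppr_le0 ival_ge0.
  - rewrite subr_le0; case: (leP (ival u) _) => ut1; first last.
      have [_ -> _] := sV _ (Vm u); congr p; apply: ival_inj; rewrite ivm.
      rewrite clampK; last by rewrite le_min ge_min !ival_ge0 ival_le1.
      by rewrite max_r // le_min !ltW.
    by rewrite fq /stop !min_l // (le_trans ut1) // ltW.
have := I01_near t e0; apply: filterS => u ue _.
by split; apply: main => //; rewrite subrr normr0.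
Qed.

End lifting.

(** * The real-valued modulus and geometric tails *)

Section complex_norm.
Context (R : realType).
Local Notation C := (R[i]^o).
Implicit Types z w : R[i].
Local Notation normc := (@Normc.normc R).
Local Open Scope complex_scope.

Lemma normcE z : `|z| = (normc z)%:C. Proof. by []. Qed.

Lemma normc_ge0 z : 0 <= normc z.
Proof. by rewrite -lecR -normcE normr_ge0. Qed.

Lemma normc_eq0 z : (normc z == 0) = (z == 0).
Proof.
by rewrite -[z == 0]normr_eq0 normcE eq_complex /= eqxx andbT.
Qed.

Lemma normc_gt0 z : (0 < normc z) = (z != 0).
Proof. by rewrite lt_def normc_ge0 andbT normc_eq0. Qed.

Lemma normcX z n : normc (z ^+ n) = normc z ^+ n.
Proof.
by elim: n => [|n IH]; rewrite ?expr0 ?Normc.normc1 // !exprS Normc.normcM IH.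
Qed.

Lemma normc_real (x : R) : normc x%:C = `|x|.
Proof. by rewrite /Normc.normc /= expr0n addr0 sqrtr_sqr. Qed.

Lemma normcB z w : normc (z - w) = normc (w - z).
Proof. by rewrite -normcN opprB. Qed.

Lemma normc_sum (I : Type) (r : seq I) (F : I -> R[i]) :
  normc (\sum_(i <- r) F i) <= \sum_(i <- r) normc (F i).
Proof.
elim: r => [|i r IH]; first by rewrite !big_nil Normc.normc0.
by rewrite !big_cons; apply: le_trans (le_normcD _ _) _; rewrite lerD2l.
Qed.

Lemma posCP (e : R[i]) : 0 < e -> e = (complex.Re e)%:C /\ 0 < complex.Re e.
Proof.
rewrite ltcE /= => /andP[/eqP e0 ?]; split => //.
by apply/eqP; rewrite eq_complex /= eqxx e0 eqxx.
Qed.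

Lemma nbhs_normcP z (N : set C) :
  nbhs (z : C) N <-> exists2 e : R, 0 < e & forall w, normc (w - z) < e -> N w.
Proof.
split.
  move=> /nbhs_ballP[e /posCP[-> e0] eN]; exists (complex.Re e) => // w wz.
  by apply: eN; rewrite /ball /= normcE ltcR normcB.
move=> [e e0 eN]; apply/nbhs_ballP; exists e%:C => /=; first by rewrite ltcR.
by move=> w; rewrite /ball /= normcE ltcR normcB; exact: eN.
Qed.

Lemma cvg_normcP (T : Type) (F : set_system T) (u : T -> C) (w : C) : Filter F ->
  (u @ F --> w) <-> forall e : R, 0 < e -> \forall t \near F, normc (u t - w) < e.
Proof.
move=> FF; split=> [uw e e0|H N /nbhs_normcP[e e0 eN]].
  by apply: (uw [set c : C | normc (c - w) < e]); apply/nbhs_normcP; exists e.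
by have := H _ e0; apply: filterS => t; exact: eN.
Qed.

Lemma normc_lim_le (T : Type) (F : set_system T) (u : T -> C) (w : C) (B : R) :
  ProperFilter F -> u @ F --> w -> (\forall t \near F, normc (u t) <= B) ->
  normc w <= B.
Proof.
move=> FF /cvg_normcP uw uB; rewrite leNgt; apply/negP => Bw.
have e0 : 0 < normc w - B by lra.
have [t [ut tB]] := filter_ex (filterI (uw _ e0) uB).
have := le_normcD (w - u t) (u t); rewrite subrK normcB; lra.
Qed.

Lemma normc_continuous : continuous (normc : C -> R).
Proof.
move=> z; apply/(@cvgrPdist_lt R R^o _ (nbhs (z : C))) => e e0.
have ne : \forall w \near (z : C), normc (w - z) < e by apply/nbhs_normcP; exists e.
near=> w; have wz : normc (w - z) < e by near: w.
rewrite ltr_distl.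
have := le_normcD (w - z) z; have := le_normcD (z - w) w.
by rewrite !subrK normcB; lra.
Unshelve. all: by end_near. Qed.

Lemma closed_disc_compact (M : R) : compact [set z : C | normc z <= M].
Proof.
pose g (u : R * R) : C := u.1 +i* u.2.
have cg : continuous g.
  by apply: continuous_Complex => u; [exact: cvg_fst | exact: cvg_snd].
have cK : compact (g @` (`[- M, M] `*` `[- M, M])).
  apply: continuous_compact; first by apply: continuous_subspaceT => u; exact: cg.
  by apply: compact_setX; exact: segment_compact.
apply: (subclosed_compact _ cK).
  rewrite (_ : [set _ | _] = normc @^-1` [set x | x <= M]) //.
  by apply: closed_comp; [move=> z _; exact: normc_continuous | exact: closed_le].
move=> [x y] /= xyM; exists (x, y) => //=.
have M0 : 0 <= M := le_trans (sqrtr_ge0 _) xyM.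
have : x ^+ 2 + y ^+ 2 <= M ^+ 2.
  by rewrite -(@sqr_sqrtr _ (_ + _)) ?addr_ge0 ?sqr_ge0 // lerXn2r ?nnegrE ?sqrtr_ge0.
rewrite !in_itv /= => xy; have := sqr_ge0 x; have := sqr_ge0 y.
by rewrite -!ler_norml -!(ler_sqr (normr_ge0 _)) ?nnegrE // !real_normK ?num_real //; lra.
Qed.

Lemma compact_normc_bounded (K : set C) : compact K ->
  exists M : R, forall z, K z -> normc z <= M.
Proof.
move=> /compact_near_coveringP/(_ R +oo%R (fun M z => normc z <= M)) [] //.
  move=> z _.
  have nz : \forall w \near (z : C), normc (w - z) < 1.
    by apply/nbhs_normcP; exists 1.
  have nM : \forall M \near +oo%R, normc z + 1 <= M by exact: nbhs_pinfty_ge (num_real _).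
  near=> w M.
  have wz : normc (w - z) < 1 by near: w.
  have zM : normc z + 1 <= M by near: M.
  by have := le_normcD (w - z) z; rewrite subrK; move=> ?; rewrite /=; lra.
move=> M [Mr MK]; exists (M + 1) => z Kz; apply: MK => //; lra.
Unshelve. all: by end_near. Qed.

(** Comparison with a geometric series of ratio 1/2, whose tail from [m] on is twice its first term;
    the induction carries the exact partial sums of that series. *)
Lemma series_tail (u : nat -> C) (U : C) (B : R) (m : nat) :
  series u @ \oo --> U ->
  (forall k, (m <= k)%N -> normc (u k) <= B * 2^-1 ^+ k) ->
  normc (U - series u m) <= 2 * B * 2^-1 ^+ m.
Proof.
move=> uU uB.
have B0 : 0 <= B.
  have := le_trans (normc_ge0 _) (uB m (leqnn m)).
  by rewrite pmulr_lge0 // exprn_gt0 // invr_gt0 ltr0n.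
have step j : normc (series u (m + j)%N - series u m) <=
    2 * B * (2^-1 ^+ m - 2^-1 ^+ (m + j)).
  elim: j => [|j IH]; first by rewrite addn0 !subrr Normc.normc0 mulr0.
  rewrite addnS seriesSr exprS.
  rewrite addrAC; apply: le_trans (le_normcD _ _) _.
  have := uB (m + j)%N (leq_addr _ _); lra.
have cv : (fun n => series u n - series u m : C) @ \oo --> (U - series u m : C).
  exact: (@cvgB _ C _ _ _ (series u) (fun=> series u m) _ _ uU (cvg_cst _)).
have PF : ProperFilter \oo by exact: eventually_filter.
apply: (@normc_lim_le nat \oo _ _ _ PF cv); exists m => // n /= mn.
rewrite -(subnKC mn); apply: le_trans (step _) _.
have : 0 <= (2^-1 : R) ^+ (m + (n - m)) by rewrite exprn_ge0 // invr_ge0 ler0n.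
by move: (2^-1 ^+ _) => x x0; nra.
Qed.

End complex_norm.

(** * Estimates on power series *)

Section power_series.
Context (R : realType) (c : nat -> R[i]) (r : R) (W : R[i] -> R[i]).
Local Notation C := (R[i]^o).
Local Notation normc := (@Normc.normc R).
Local Open Scope complex_scope.
Hypotheses (r0 : 0 < r) (cW : forall h, normc h < r ->
  series (fun k => c k * h ^+ k : C) @ \oo --> (W h : C)).

(** The terms of the series at the real point [rho] tend to zero, hence are bounded. *)
Lemma ps_coef_bound : exists rho M : R, [/\ 0 < rho, rho < r, 0 < M &
  forall k, normc (c k) * rho ^+ k <= M].
Proof.
have r0' := r0; pose rho := r / 2; have rho0 : 0 < rho by rewrite /rho; lra.
have rhoC : normc rho%:C = rho by rewrite normc_real ger0_norm // ltW.
have cvW : series (fun k => c k * rho%:C ^+ k : C) @ \oo --> (W rho%:C : C).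
  by apply: cW; rewrite rhoC /rho; lra.
have cvg1 : cvgn (series (fun k => c k * rho%:C ^+ k : C)).
  by apply/cvg_ex; exists (W rho%:C).
have /cvg_normcP/(_ 1 ltr01)[N _ HN] := cvg_series_cvg_0 cvg1.
exists rho, (1 + \sum_(k < N) normc (c k) * rho ^+ k).
have F0 k : 0 <= normc (c k) * rho ^+ k.
  by rewrite mulr_ge0 ?normc_ge0 // exprn_ge0 // ltW.
have S0 : 0 <= \sum_(k < N) normc (c k) * rho ^+ k by exact: sumr_ge0.
split => //; [by rewrite /rho; lra | by lra|] => k.
have [Nk|kN] := leqP N k.
  have := HN k Nk; rewrite /= subr0 Normc.normcM normcX rhoC; lra.
rewrite (bigD1 (Ordinal kN)) //=.
have : 0 <= \sum_(i < N | i != Ordinal kN) normc (c i) * rho ^+ i by exact: sumr_ge0.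
lra.
Qed.

(** Once [|h| < rho / 2], the coefficient bound puts the terms after [c m * h ^+ m] below a
    geometric series of ratio 1/2 with a factor [|h| ^+ m.+1]. *)
Lemma ps_leading m : (forall k, (k < m)%N -> c k = 0) ->
  exists K d : R, [/\ 0 < K, 0 < d, d < r & forall h, normc h < d ->
    normc (W h - c m * h ^+ m) <= K * normc h ^+ m.+1].
Proof.
move=> cm0; have [rho [M [rho0 rhor M0 cM]]] := ps_coef_bound.
exists (2 * M * rho^-1 ^+ m.+1), (rho / 2); split; [|lra|lra|].
  by rewrite mulr_gt0 ?exprn_gt0 ?invr_gt0 //; lra.
move=> h hd; pose x := normc h / rho.
have x0 : 0 <= x by rewrite /x divr_ge0 ?normc_ge0 // ltW.
have x1 : x <= 2^-1 by rewrite /x ler_pdivrMr //; lra.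
have hx : normc h = x * rho by rewrite /x divfK // gt_eqF.
have E : series (fun k => c k * h ^+ k : C) m.+1 = c m * h ^+ m.
  rewrite /series /= big_nat_recr //= big_nat big1 ?add0r // => i /andP[_ im].
  by rewrite cm0 // mul0r.
rewrite -E.
have := @series_tail _ (fun k => c k * h ^+ k : C) (W h) (M * (2 * x) ^+ m.+1) m.+1.
rewrite (_ : 2 * _ * _ = 2 * M * rho^-1 ^+ m.+1 * normc h ^+ m.+1); last first.
  rewrite hx !exprMn !exprVn; field; rewrite !expf_neq0 ?gt_eqF //.
apply; first by apply: cW; lra.
move=> k mk; rewrite Normc.normcM normcX hx exprMn -[X in _ <= X]mulrA.
have := cM k; have : 0 <= x ^+ k by exact: exprn_ge0.
have -> : (2 * x) ^+ m.+1 * 2^-1 ^+ k = x ^+ m.+1 * 2^-1 ^+ (k - m.+1).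
  rewrite -[in 2^-1 ^+ k](subnKC mk) exprD mulrA -exprMn.
  by rewrite mulrAC mulfV ?mul1r // pnatr_eq0.
rewrite -[in x ^+ k](subnKC mk) exprD => xk cMk.
have xk' : x ^+ m.+1 * x ^+ (k - m.+1) <= x ^+ m.+1 * 2^-1 ^+ (k - m.+1).
  by rewrite ler_wpM2l ?exprn_ge0 // lerXn2r ?nnegrE // invr_ge0 ler0n.
rewrite [_ * rho ^+ k]mulrC mulrA.
apply: le_trans (_ : M * (x ^+ m.+1 * x ^+ (k - m.+1)) <= _); last first.
  by rewrite ler_pM2l.
by rewrite ler_wpM2r.
Qed.

(** Strict differentiability at the centre: the nonlinear part of [W] has Lipschitz constant
    proportional to the radius [d], because [h ^+ n - h' ^+ n] is [h - h'] times a factor of modulus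
    at most [n * d ^+ (n - 1)]. *)
Lemma ps_lipschitz : exists K d0 : R, [/\ 0 < K, 0 < d0, d0 < r &
  forall d h h', d <= d0 -> normc h <= d -> normc h' <= d ->
    normc (W h - W h' - c 1%N * (h - h')) <= K * d * normc (h - h')].
Proof.
have [rho [M [rho0 rhor M0 cM]]] := ps_coef_bound.
(* The radius [rho / 4] gives [2 * d / rho <= 1 / 2], so the terms decay geometrically even after
   [n] is replaced by [2 ^+ n]. *)
exists (8 * M * rho^-1 ^+ 2), (rho / 4); split; [|lra|lra|].
  by rewrite mulr_gt0 ?exprn_gt0 ?invr_gt0 //; lra.
move=> d h h' dd hd h'd; pose y := d / rho.
have d0 : 0 <= d := le_trans (normc_ge0 _) hd.
have y0 : 0 <= y by rewrite /y divr_ge0 // ltW.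
have y1 : 2 * y <= 2^-1 by rewrite /y mulrA ler_pdivrMr //; lra.
have dy : d = y * rho by rewrite /y divfK // gt_eqF.
clearbody y; pose u k : C := c k * (h ^+ k - h' ^+ k).
have E : series u 2 = c 1%N * (h - h').
  by rewrite /series /= !big_nat_recr //= big_nil /u !expr0 subrr mulr0 !add0r !expr1.
have uW : series u @ \oo --> (W h - W h' : C).
  rewrite (_ : series u = fun n => series (fun k => c k * h ^+ k : C) n -
      series (fun k => c k * h' ^+ k : C) n); last first.
    apply/funext => n; rewrite /series /= -sumrB; apply: eq_bigr => k _.
    by rewrite /u mulrBr.
  apply: (@cvgB _ C _ _ _ (series (fun k => c k * h ^+ k : C))
    (series (fun k => c k * h' ^+ k : C)) _ _); apply: cW; lra.
rewrite -E.
have := @series_tail _ u (W h - W h') (16 * M * d * rho^-1 ^+ 2 * normc (h - h')) 2%N uW.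
rewrite (_ : 2 * _ * _ = 8 * M * rho^-1 ^+ 2 * d * normc (h - h')); last by field; rewrite gt_eqF.
apply=> -[|[|k]] // _.
set n := k.+2; rewrite /u subrXX !Normc.normcM.
have S : normc (\sum_(i < n) h ^+ (n.-1 - i) * h' ^+ i) <= n%:R * d ^+ n.-1.
  apply: le_trans (normc_sum _ _) _.
  rewrite -[X in X%:R * _]card_ord -sum1_card natr_sum mulr_suml; apply: ler_sum => i _.
  rewrite Normc.normcM !normcX mul1r.
  have -> : n.-1 = (n.-1 - i + i)%N by rewrite subnK // -ltnS prednK.
  rewrite addnK exprD ler_pM ?exprn_ge0 ?normc_ge0 // lerXn2r ?nnegrE ?normc_ge0 //.
rewrite mulrCA mulrC -[X in _ <= X]mulrA [normc _ * 2^-1 ^+ _]mulrC [X in _ <= X]mulrA.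
rewrite ler_wpM2r ?normc_ge0 //.
apply: le_trans (_ : normc (c n) * (n%:R * d ^+ n.-1) <= _).
  by rewrite ler_wpM2l ?normc_ge0.
(* n <= 2 ^ n bounds n y ^ (n - 1) by a geometric sequence. *)
have n2 : (n%:R : R) <= 2 ^+ n by rewrite -natrX ler_nat ltnW // ltn_expl.
have cn : normc (c n) * rho ^+ n.-1 <= M / rho.
  by rewrite ler_pdivlMr // -mulrA -exprSr cM.
have y2 : 2 ^+ n * y ^+ n.-1 <= 4 * y * 2^-1 ^+ k.
  rewrite exprS -mulrA -exprMn /n /= exprS.
  have yk : (2 * y) ^+ k <= 2^-1 ^+ k.
    by apply: lerXn2r => //; rewrite nnegrE ?mulr_ge0 ?invr_ge0.
  rewrite mulrA (_ : 2 * (2 * y) = 4 * y); last by ring.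
  by rewrite ler_wpM2l // mulr_ge0.
have -> : normc (c n) * (n%:R * d ^+ n.-1) =
    (normc (c n) * rho ^+ n.-1) * (n%:R * y ^+ n.-1).
  by rewrite dy exprMn; ring.
have -> : 16 * M * d * rho^-1 ^+ 2 * 2^-1 ^+ n = M / rho * (4 * y * 2^-1 ^+ k).
  by rewrite /n dy !exprS; field; rewrite gt_eqF.
apply: ler_pM => //.
- by rewrite mulr_ge0 ?normc_ge0 // exprn_ge0 // ltW.
- by rewrite mulr_ge0 // exprn_ge0.
- by apply: le_trans y2; rewrite ler_wpM2r // exprn_ge0.
Qed.

End power_series.

(** * Charts and topology of the sphere *)

Section charts.
Context (R : realType).
Local Notation C := (R[i]^o).
Local Notation normc := (@Normc.normc R).
Local Open Scope complex_scope.
Implicit Types (a b : P1 R) (h w : R[i]).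

Lemma chart0 a : chart a 0 = a.
Proof. by case: a => [z|] /=; rewrite ?addr0 // eqxx. Qed.

Lemma chart_inj a : injective (chart a).
Proof.
case: a => [z|] h h' /=; first by move=> [/addrI].
by have [->|h0] := eqVneq h 0; have [->|h'0] := eqVneq h' 0 => // -[/invr_inj].
Qed.

Lemma pt_nbhsP (z : R[i]) (N : set (P1 R)) :
  nbhs (pt z) N <-> \forall w \near (z : C), N (pt w).
Proof. by []. Qed.

(** At infinity, inversion exchanges small discs around 0 with complements of large closed discs,
    and every compact set of the plane lies in a large disc. *)
Lemma nbhs_chart0P a (N : set (P1 R)) :
  nbhs a N <-> \forall h \near (0 : C), N (chart a h).
Proof.
split.
  case: a => [z|] Na; apply/nbhs_normcP.
    have /pt_nbhsP/nbhs_normcP[e e0 eN] := Na.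
    by exists e => // h; rewrite subr0 => he; apply: eN; rewrite addrC addKr.
  move: Na => [K [/compact_normc_bounded[M KM] _] KN].
  exists (`|M| + 1)^-1; first by rewrite invr_gt0; have := normr_ge0 M; lra.
  move=> h; rewrite subr0 => hM /=; apply: KN.
  have [h0|h0] := eqVneq h 0; [by right | left; exists h^-1 => // /KM].
  have n0 : 0 < normc h by rewrite normc_gt0.
  move: hM; rewrite -[X in X < _]invrK ltf_pV2 ?posrE ?invr_gt0 //.
    by rewrite -Normc.normcV; have := ler_norm M; lra.
  by have := normr_ge0 M; lra.
case: a => [z|] /nbhs_normcP[e e0 eN].
  apply/pt_nbhsP/nbhs_normcP; exists e => // w wz.
  by rewrite -[w](subrK z) addrC; apply: eN; rewrite subr0.
exists [set w : C | normc w <= 2 / e].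
  split; first exact: closed_disc_compact.
  apply: compact_closed; first exact: norm_hausdorff.
  exact: closed_disc_compact.
move=> _ [[w /= we <-]|->]; last first.
  by rewrite -[None](chart0 (infty R)); apply: eN; rewrite subrr Normc.normc0.
move: we => /negP; rewrite -ltNge => we.
have w0 : 0 < normc w by apply: le_lt_trans we; rewrite divr_ge0 // ltW.
have nw : w != 0 by rewrite -normc_gt0.
have := eN w^-1; rewrite /= invr_eq0 (negbTE nw) invrK; apply.
rewrite subr0 Normc.normcV -[e]invrK ltf_pV2 ?posrE ?invr_gt0 //.
by apply: le_lt_trans we; rewrite ler_peMl ?invr_ge0 ?ltW // ltr1n.
Qed.

Lemma nbhs_chartP a h (N : set (P1 R)) :
  nbhs (chart a h) N <-> \forall h' \near (h : C), N (chart a h').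
Proof.
case: a => [z|].
  split=> [/pt_nbhsP|] /nbhs_normcP[e e0 eN].
    apply/nbhs_normcP; exists e => // h' hh; apply: eN.
    by rewrite opprD addrACA subrr add0r.
  apply/pt_nbhsP/nbhs_normcP; exists e => // w wh.
  have := eN (w - z); rewrite /= [z + _]addrC subrK; apply.
  by rewrite -addrA -opprD.
have [->|h0] := eqVneq h 0; first by rewrite chart0 nbhs_chart0P.
have near0 (g : C) : g != 0 -> \forall h' \near g, h' != 0.
  move=> g0; apply/nbhs_normcP; exists (normc g); first by rewrite normc_gt0.
  by move=> w; apply: contraTneq => ->; rewrite sub0r normcN ltxx.
have icont (g : C) : g != 0 -> (fun w : C => w^-1 : C) @ g --> (g^-1 : C).
  by move=> g0; exact: (@cvgV _ _ (nbhs g) _ id g).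
rewrite /= (negbTE h0); split=> [/pt_nbhsP|] H.
  have n1 := near0 _ h0; have n2 : \forall h' \near (h : C), N (pt h'^-1) := icont _ h0 _ H.
  near=> h'.
  have -> /= : (h' == 0) = false by apply/negbTE; near: h'.
  by near: h'.
apply/pt_nbhsP.
have hV0 : h^-1 != 0 by rewrite invr_eq0.
have n1 := near0 _ hV0.
have n2 : \forall w \near (h^-1 : C), N (chart (infty R) w^-1).
  by apply: (icont _ hV0 [set w | N (chart (infty R) w)]); rewrite /= invrK.
near=> w.
have w0 : w != 0 by near: w.
have : N (chart (infty R) w^-1) by near: w.
by rewrite /= invr_eq0 (negbTE w0) invrK.
Unshelve. all: by end_near. Qed.

(** To separate infinity from a finite [z], take the disc of radius [normc z + 1] and its
    complement. *)
Lemma P1_hausdorff : hausdorff_space (P1 R).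
Proof.
have C2 : hausdorff_space C by exact: norm_hausdorff.
have infP z : cluster (nbhs (pt z)) (infty R) -> False.
  move=> /(_ [set v | exists2 w, normc w < normc z + 1 & v = pt w]
    [set v | forall w, normc w < normc z + 1 -> v <> pt w])[].
  - apply/pt_nbhsP/nbhs_normcP; exists 1 => // w wz; exists w => //.
    by have := le_normcD (w - z) z; rewrite subrK; lra.
  - apply/nbhs_chart0P/nbhs_normcP; exists (normc z + 1)^-1.
      by rewrite invr_gt0; have := normc_ge0 z; lra.
    move=> h; rewrite subr0 /=; case: eqP => // /eqP h0 hz w wz [hw].
    move: wz; rewrite -hw Normc.normcV ltNge => /negP[].
    have z1 : 0 < normc z + 1 by have := normc_ge0 z; lra.
    by rewrite -[_ + 1]invrK lef_pV2 ?posrE ?invr_gt0 ?normc_gt0 // ltW.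
  by move=> _ [[w wz ->]] /(_ w wz).
move=> [z|] [w|] //.
- move=> zw; congr pt; apply: C2 => A B zA wB.
  have [] := zw (Some @` A) (Some @` B).
  + by apply/pt_nbhsP; apply: filterS zA => u; exists u.
  + by apply/pt_nbhsP; apply: filterS wB => u; exists u.
  by move=> _ [[u Au <-] [u' Bu [E]]]; exists u; split => //; rewrite -E.
- by move=> /infP.
- by move=> H; case: (infP w) => A B wA iB; have [v []] := H _ _ iB wA; exists v.
Qed.

End charts.

(** * Local structure of maps with Taylor expansions *)

Section local_structure.
Context (R : realType) (beta : P1 R -> P1 R).
Local Notation C := (R[i]^o).
Local Notation normc := (@Normc.normc R).
Local Open Scope complex_scope.

(** The constant coefficient vanishes because both charts are centred: at [h = 0] the series gives
    [W 0 = c 0], and the chart at [beta a] is injective. *)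
Lemma taylor_local_form a c : taylor beta a c ->
  exists (r : R) (W : R[i] -> R[i]), [/\ 0 < r,
    (forall h, normc h < r -> series (fun k => c k * h ^+ k : C) @ \oo --> (W h : C)),
    (forall h, normc h < r -> beta (chart a h) = chart (beta a) (W h)) &
    c 0%N = 0].
Proof.
move=> [r r0 H].
pose P h (w : R[i]) := (series (fun k => c k * h ^+ k : C) @ \oo --> (w : C)) /\
  beta (chart a h) = chart (beta a) w.
pose W h := xget 0 [set w | P h w].
have PW h : normc h < r -> P h (W h).
  move=> hr; have [|w w1 w2] := H h; first by rewrite normcE ltcR.
  by apply: (@xgetPex _ 0 [set w | P h w]); exists w.
have cW h : normc h < r -> series (fun k => c k * h ^+ k : C) @ \oo --> (W h : C).
  by move=> /PW[].
exists r, W; split => // [h /PW[]//|].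
have [//|K [d [K0 d0 dr]]] := ps_leading r0 cW (m := 0%N).
move=> /(_ 0); rewrite Normc.normc0 expr1 mulr0 => /(_ d0).
rewrite expr0 mulr1 => Wc.
have {Wc} : W 0 - c 0%N == 0 by rewrite -normc_eq0 eq_le Wc normc_ge0.
rewrite subr_eq0 => /eqP <-; apply: (@chart_inj _ (beta a)).
by have [_ <-] := PW 0 (eq_ind_r (fun x => x < r) r0 (Normc.normc0 R)); rewrite !chart0.
Qed.

Lemma taylor_continuous a c : taylor beta a c -> {for a, continuous beta}.
Proof.
move=> /taylor_local_form[r [W [r0 cW bW c0]]] N /nbhs_chart0P/nbhs_normcP[e e0 eN].
have [//|K [d [K0 d0 dr HW]]] := ps_leading r0 cW (m := 0%N).
apply/nbhs_chart0P/nbhs_normcP; exists (Num.min d (e / K)).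
  by rewrite lt_min d0 divr_gt0.
move=> h; rewrite subr0 lt_min => /andP[hd he] /=.
rewrite bW ?(lt_trans hd) //; apply: eN; rewrite subr0.
have := HW h hd; rewrite c0 mul0r subr0 expr1 => /le_lt_trans; apply.
by rewrite mulrC -ltr_pdivlMr.
Qed.

(** If [c m] is the first nonzero coefficient, [W h = 0] with [h] small and nonzero forces
    [|c m| <= K * |h|]. The constant case stays as an alternative, to be excluded along arcs on
    which [beta] varies. *)
Lemma taylor_isolated a c : taylor beta a c ->
  (\forall y \near a, beta y = beta a) \/ (\forall y \near a, beta y = beta a -> y = a).
Proof.
move=> /taylor_local_form[r [W [r0 cW bW c0]]].
have [c_all|/existsNP[k0 ck0]] := pselect (forall k, c k = 0).
  left; apply/nbhs_chart0P/nbhs_normcP; exists r => // h; rewrite subr0 => hr.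
  rewrite bW // (_ : W h = 0) ?chart0 //; apply/eqP; rewrite -normc_eq0 eq_le normc_ge0.
  rewrite andbT; apply: (@normc_lim_le _ nat \oo _ _ _ _ (cW _ hr)); apply: nearW => n.
  by rewrite /series /= big1 ?Normc.normc0 // => k _; rewrite c_all mul0r.
right; have ex : exists k, c k != 0 by exists k0; apply/eqP.
have [m cm mmin] := ex_minnP ex.
have cm0 k : (k < m)%N -> c k = 0.
  by move=> km; apply/eqP; apply: contraTT km => /mmin; rewrite -leqNgt.
have [K [d [K0 d0 dr HW]]] := ps_leading r0 cW cm0.
have ncm : 0 < normc (c m) by rewrite normc_gt0.
apply/nbhs_chart0P/nbhs_normcP; exists (Num.min d (normc (c m) / K)).
  by rewrite lt_min d0 divr_gt0.
move=> h; rewrite subr0 lt_min => /andP[hd hc].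
rewrite bW ?(lt_trans hd) // -[X in _ = X](chart0 (beta a)) => /chart_inj Wh.
have [->|h0] := eqVneq h 0; first exact: chart0.
have := HW _ hd; rewrite Wh sub0r normcN Normc.normcM normcX exprSr mulrA.
rewrite mulrAC ler_pM2r ?exprn_gt0 ?normc_gt0 //.
by move: hc; rewrite ltr_pdivlMr // mulrC => /lt_le_trans H /H; rewrite ltxx.
Qed.

(* The minimum of |W h - w| over the closed disc is attained at an interior
   point, and moving from there in the direction - (W h - w) / c1 decreases it
   unless it is zero. *)
Lemma almost_linear_surjective (W : R[i] -> R[i]) (c1 : R[i]) (d : R) :
  c1 != 0 -> 0 < d -> W 0 = 0 ->
  (forall h h', normc h <= d -> normc h' <= d ->
    normc (W h - W h' - c1 * (h - h')) <= normc c1 / 2 * normc (h - h')) ->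
  forall w, normc w < normc c1 * d / 4 -> exists2 h, normc h < d & W h = w.
Proof.
move=> c10 d0 W0 HW w wd.
have nc1 : 0 < normc c1 by rewrite normc_gt0.
pose D : set C := [set h : C | normc h <= d].
have D00 : D (0 : R[i]) := eq_ind_r (fun x => x <= d) (ltW d0) (Normc.normc0 R).
have D0 : D !=set0 by exists (0 : R[i]).
pose g (h : R[i]) : R := normc (W h - w).
have gL (h h' : R[i]) : D h -> D h' -> g h <= g h' + 2 * normc c1 * normc (h - h').
  move=> Dh Dh'; rewrite /g.
  have -> : W h - w = (W h' - w) + (W h - W h' - c1 * (h - h')) + c1 * (h - h') by ring.
  apply: le_trans (le_normcD _ _) _; rewrite Normc.normcM.
  apply: le_trans (lerD (le_normcD _ _) (lexx _)) _.
  have := HW _ _ Dh Dh'; have := normc_ge0 (h - h'); nra.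
have cg : {within D, continuous (g : C -> R)}.
  apply/subspace_continuousP => /= x; move: (x : R[i]) => {}x Dx.
  apply/(@cvgrPdist_lt R R^o _ (within D (nbhs (x : C)))) => e e0.
  have n1 : \forall y \near (x : C), normc ((y : R[i]) - x) < e / (2 * normc c1).
    by apply/nbhs_normcP; exists (e / (2 * normc c1)) => //; rewrite divr_gt0 // mulr_gt0.
  near=> y; have Dy : D y by near: y; exact: withinT.
  have : normc ((y : R[i]) - x) < e / (2 * normc c1) by near: y; apply: cvg_within.
  rewrite ltr_pdivlMr ?mulr_gt0 // mulrC => yx.
  have := gL _ _ Dx Dy; have := gL _ _ Dy Dx; rewrite [normc (x - y)]normcB.
  by move=> A B; rewrite -[from_subspace _ _]/g ltr_distl; apply/andP; split; lra.
have [h [Dh hmin]] : exists h : R[i], normc h <= d /\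
    forall h' : R[i], normc h' <= d -> normc (W h - w) <= normc (W h' - w).
  have [h /set_mem Dh hmin] := compact_EVT_min D0 (@closed_disc_compact R d) cg.
  by exists h; split => // h' Dh'; exact: hmin (mem_set Dh').
have g0 : normc (W 0 - w) = normc w by rewrite W0 sub0r normcN.
(* On the boundary circle [|W h|] is at least [|c1| * d / 2], so [|W h - w|] exceeds [|w|], its
   value at 0. *)
have hd : normc h < d.
  rewrite lt_neqAle Dh andbT; apply/eqP => hd.
  have := hmin 0 D00; rewrite g0 => gh.
  have := HW h 0 Dh D00; rewrite W0 !subr0 normcB hd => H.
  have := le_normcD (c1 * h - W h + (W h - w)) w; have := le_normcD (c1 * h - W h) (W h - w).
  rewrite (_ : c1 * h - W h + (W h - w) + w = c1 * h); last by ring.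
  by rewrite Normc.normcM hd; nra.
exists h => //; apply/eqP; rewrite -subr_eq0; apply/negPn/negP => dn0.
set delta := W h - w in dn0; have nd : 0 < normc delta by rewrite normc_gt0.
(* The step is capped so that [h - k] stays in the disc; the error term gives back at most half of
   the decrease [t * normc delta]. *)
pose t := Num.min 1 ((d - normc h) * normc c1 / normc delta).
have t0 : 0 < t by rewrite lt_min ltr01 divr_gt0 // mulr_gt0 // subr_gt0.
have t1 : t <= 1 by rewrite ge_min lexx.
have td : t * (normc delta / normc c1) <= d - normc h.
  rewrite mulrA ler_pdivrMr // -ler_pdivlMr // ge_min lexx orbT //.
pose k := t%:C * (delta / c1).
have nk : normc k = t * (normc delta / normc c1).
  by rewrite /k !Normc.normcM Normc.normcV normc_real gtr0_norm.
have Dh' : normc (h - k) <= d.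
  by have := le_normcD h (- k); rewrite normcN nk; lra.
have := hmin _ Dh'; rewrite leNgt => /negP; apply.
have -> : W (h - k) - w = (W (h - k) - W h - c1 * (h - k - h)) + (1 - t)%:C * delta.
  by rewrite /k /delta rmorphB rmorph1; field.
rewrite (_ : h - k - h = - k); last by ring.
apply: le_lt_trans (le_normcD _ _) _.
have := HW _ _ Dh' Dh; rewrite (_ : h - k - h = - k); last by ring.
rewrite [normc (- k)]normcN nk.
rewrite [_ / 2 * _](_ : _ = t * normc delta / 2); last by field; rewrite gt_eqF.
rewrite Normc.normcM normc_real ger0_norm ?subr_ge0 //.
by nra.
Unshelve. all: by end_near. Qed.

(** A quantitative inverse function theorem: on a small disc [W] differs from multiplication by
    [c 1] by at most half of that slope, so it is injective with Lipschitz inverse and covers a disc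
    of radius [eta]. *)
Lemma unbranched_etale a : unbranched_at beta a -> etale_at beta a.
Proof.
move=> [c /taylor_local_form[r [W [r0 cW bW c0]]] c1].
have [//|K0 [d1 [_ d10 d1r HW0]]] := ps_leading r0 cW (m := 0%N).
have W0 : W 0 = 0.
  have := HW0 0; rewrite Normc.normc0 => /(_ d10).
  rewrite c0 mul0r subr0 expr1 mulr0 => H.
  by apply/eqP; rewrite -normc_eq0 eq_le H normc_ge0.
have [K [d0 [Kpos d0pos d0r HW]]] := ps_lipschitz r0 cW.
have nc1 : 0 < normc (c 1%N) by rewrite normc_gt0.
(* Small enough for the Lipschitz constant [K * d] of the nonlinear part to be at most half of
   [normc (c 1%N)]. *)
pose d := Num.min d0 (normc (c 1%N) / 2 / K).
have dpos : 0 < d by rewrite lt_min d0pos !divr_gt0.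
have dd0 : d <= d0 by rewrite ge_min lexx.
have dr : d < r by exact: le_lt_trans d0r.
have Kd : K * d <= normc (c 1%N) / 2.
  by rewrite mulrC -ler_pdivlMr // ge_min lexx orbT.
have HL h h' : normc h <= d -> normc h' <= d ->
    normc (W h - W h' - c 1%N * (h - h')) <= normc (c 1%N) / 2 * normc (h - h').
  move=> hd h'd; apply: le_trans (HW d h h' dd0 hd h'd) _.
  by rewrite ler_wpM2r ?normc_ge0.
have Hinv h h' : normc h <= d -> normc h' <= d ->
    normc (c 1%N) / 2 * normc (h - h') <= normc (W h - W h').
  move=> hd h'd; have := HL h h' hd h'd.
  have := le_normcD (c 1%N * (h - h') - (W h - W h')) (W h - W h').
  rewrite subrK [normc (_ * _ - _)]normcB Normc.normcM; lra.
have Winj h h' : normc h <= d -> normc h' <= d -> W h = W h' -> h = h'.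
  move=> hd h'd E; have := Hinv h h' hd h'd; rewrite E subrr Normc.normc0.
  rewrite pmulr_rle0 ?divr_gt0 // => H; apply/eqP.
  by rewrite -subr_eq0 -normc_eq0 eq_le H normc_ge0.
pose eta := normc (c 1%N) * d / 4.
have eta0 : 0 < eta by rewrite divr_gt0 // mulr_gt0.
have surj := almost_linear_surjective c1 dpos W0 HL.
pose near_sol v : set R[i] := [set h | normc h < d /\ beta (chart a h) = v].
pose s v := chart a (xget 0 (near_sol v)).
have sol_uniq h h' : normc h < d -> normc h' < d ->
    beta (chart a h) = beta (chart a h') -> h = h'.
  move=> hd h'd; rewrite !bW ?(lt_trans _ dr) // => /chart_inj.
  by apply: Winj; exact: ltW.
have sK h : normc h < d -> s (beta (chart a h)) = chart a h.
  move=> hd; rewrite /s; congr chart.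
  have [h'd h'E] : near_sol (beta (chart a h)) (xget 0 (near_sol (beta (chart a h)))).
    by apply: xgetPex; exists h.
  exact: sol_uniq.
exists (chart (beta a) @` [set w | normc w < eta]), s; split.
- rewrite openE => _ [w /= we <-]; apply/nbhs_chartP/nbhs_normcP.
  exists (eta - normc w); first by rewrite subr_gt0.
  move=> w' ww'; exists w' => //=.
  by have := le_normcD (w' - w) w; rewrite subrK; lra.
- exists 0; last exact: chart0.
  exact: (eq_ind_r (fun x => x < eta) eta0 (Normc.normc0 R)).
- by rewrite -{1}[a]chart0 sK ?chart0 // Normc.normc0.
move=> _ [w /= we <-]; have [h hd Wh] := surj w we.
have bh : beta (chart a h) = chart (beta a) w by rewrite bW ?Wh // (lt_trans hd).
rewrite -bh sK //; split => //; last first.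
  apply/nbhs_chartP/nbhs_normcP; exists (d - normc h); first by rewrite subr_gt0.
  move=> h' hh'; apply: sK.
  by have := le_normcD (h' - h) h; rewrite subrK; lra.
move=> N; rewrite sK // bh => /nbhs_chartP/nbhs_normcP[e e0 eN].
apply/nbhs_chartP/nbhs_normcP.
exists (Num.min (eta - normc w) (e * (normc (c 1%N) / 2))).
  by rewrite lt_min subr_gt0 we mulr_gt0 // divr_gt0.
move=> w'; rewrite lt_min => /andP[w'1 w'2] /=.
have w'e : normc w' < eta by have := le_normcD (w' - w) w; rewrite subrK; lra.
have [h' h'd Wh'] := surj w' w'e.
have -> : chart (beta a) w' = beta (chart a h') by rewrite bW ?Wh' // (lt_trans h'd).
rewrite sK //; apply: eN.
have := Hinv h' h (ltW h'd) (ltW hd); rewrite Wh Wh' => H.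
have := le_lt_trans H w'2; rewrite mulrC ltr_pM2r // divr_gt0 //.
Qed.

End local_structure.

(** * Limits of lifted arcs at branch values *)

Section open_arc_limit.
Context (R : realType) (Y Z : topologicalType) (f : Y -> Z).
Hypotheses (cY : compact [set: Y]) (hY : hausdorff_space Y) (hZ : hausdorff_space Z).
Hypothesis cf : continuous f.

Lemma unit_interval_proper (t0 : R) : 0 <= t0 <= 1 ->
  ProperFilter (within `]0, 1[%classic (nbhs t0)).
Proof.
move=> /andP[t00 t01]; apply: Build_ProperFilter_ex => P [/= e e0 eP].
pose d := Num.min 1 e; have d0 : 0 < d by rewrite lt_min ltr01 e0.
have d1 : d <= 1 by rewrite ge_min lexx.
have de : d <= e by rewrite ge_min lexx orbT.
(* Contracting [t0] towards 1/2 lands in the open interval even when [t0] is an end. *)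
exists ((1 - d) * t0 + d / 2); apply: eP => /=.
  by rewrite ltr_norml; apply/andP; split; nra.
by rewrite in_itv /=; apply/andP; split; nra.
Qed.

Lemma unit_interval_ball_connected (t0 e : R) :
  connected (`]0, 1[ `&` [set t | `|t - t0| < e])%classic.
Proof.
apply/connected_intervalP => x y [+ +] [+ +] z /andP[xz zy] /=.
by rewrite /= !in_itv /= !ltr_distl => /andP[? ?] /andP[? ?] /andP[? ?] /andP[? ?];
  split; apply/andP; split; lra.
Qed.

(* A cluster point of g at t0 lies over gam t0 and is isolated in its fibre, as
   f is not constant along g; a small sphere around it has compact image
   missing gam t0, hence is not crossed by g near t0. *)
Lemma open_arc_limit (g : R -> Y) (gam : R -> Z) (t0 : R) : 0 <= t0 <= 1 ->
  (forall t, 0 < t < 1 -> {for t, continuous g}) ->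
  (forall t, 0 < t < 1 -> f (g t) = gam t) ->
  {for t0, continuous gam} ->
  (forall t, 0 < t < 1 -> gam t <> gam t0) ->
  (forall y, (\forall y' \near y, f y' = f y) \/
             (\forall y' \near y, f y' = f y -> y' = y)) ->
  exists2 y, f y = gam t0 & g @ within `]0, 1[%classic (nbhs t0) --> y.
Proof.
move=> t001 cg fg cgam gamt0 iso.
have PF := unit_interval_proper t001.
have inA (P : R -> Prop) : (forall t, 0 < t < 1 -> P t) ->
    \forall t \near within `]0, 1[%classic (nbhs t0), P t.
  by move=> H; rewrite near_withinE; near=> t; rewrite /= in_itv; exact: H.
have [y0 [_ y0cl]] := cY (F := g @ within `]0, 1[%classic (nbhs t0)) _ filterT.
have fy0 : f y0 = gam t0.
  apply/esym/hZ => B C Bg Cf.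
  have nB : \forall t \near within `]0, 1[%classic (nbhs t0), B (f (g t)).
    have nB : \forall t \near t0, B (gam t) := cgam _ Bg.
    rewrite near_withinE; near=> t; rewrite /= in_itv /= => t01.
    by rewrite fg //; near: t.
  have [y [By Cy]] := y0cl (f @^-1` B) (f @^-1` C) nB (cf Cf).
  by exists (f y).
have [cst0|iso0] := iso y0.
  have nS : \forall t \near within `]0, 1[%classic (nbhs t0), f (g t) <> gam t0.
    by apply: inA => t t01; rewrite fg //; exact: gamt0.
  have [y [/= Sy]] := y0cl (fun y => f y <> gam t0) _ nS cst0.
  by rewrite fy0.
exists y0 => // N Ny0.
(* Regularity gives [V] whose closure lies in [N] and meets the fibre of [y0] in [y0] alone; [K] is
   its boundary. *)
have [V nV VN] : filter_from (nbhs y0) closure (N `&` [set y | f y = f y0 -> y = y0]).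
  by apply: (compact_regular hY cY filterT); exact: filterI.
pose K := closure V `\` V^°.
have clK : closed K.
  rewrite /K setDE; apply: closedI; first exact: closed_closure.
  by apply: open_closedC; exact: open_interior.
have cfK : closed (f @` K).
  apply: compact_closed => //; apply: continuous_compact.
    by apply: continuous_subspaceT; exact: cf.
  exact: (subclosed_compact clK cY).
have nK : ~ (f @` K) (gam t0).
  move=> [y [yV nyV] fy]; have [_ /(_ _)] := VN _ yV.
  by rewrite /= fy fy0 => /(_ erefl) Ey; apply: nyV; rewrite Ey; exact: nV.
have nfK : \forall t \near t0, ~ (f @` K) (gam t).
  by apply: (cgam (~` (f @` K))); apply: open_nbhs_nbhs; split => //; exact: closed_openC.
have /nbhs_ballP[e /= e0 eK] := nfK.
pose A := (`]0, 1[ `&` [set t | `|t - t0| < e])%classic.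
have nA : within `]0, 1[%classic (nbhs t0) A.
  rewrite /within /=; apply/nbhs_ballP; exists e => // t te tA; split => //.
  by rewrite /= distrC.
(* As the arc misses [K], it is at each time in the interior of [V] or outside its closure, two open
   alternatives. *)
have dich t : A t -> V^° (g t) \/ ~ closure V (g t).
  move=> [+ te]; rewrite /= in_itv /= => t01.
  have [|nV'] := pselect (closure V (g t)); last by right.
  move=> Vt; left; apply: contrapT => nVt; apply: (eK t); first by rewrite /ball /= distrC.
  by rewrite -fg //; exists (g t).
have [_ [[t1 At1 <-] Vt1]] : exists y, (g @` A) y /\ V^° y.
  apply: y0cl; last by apply: open_nbhs_nbhs; split; [exact: open_interior|exact: nV].
  by apply: filterS nA => t At; exists t.
have AV : forall t, A t -> V^° (g t).
  move=> t At.
  have step u : A u -> \forall v \near u, A v -> (V^° (g v) <-> V^° (g u)).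
    move=> Au; have cgu : {for u, continuous g}.
      by apply: cg; case: Au; rewrite /= in_itv.
    have [Vu|nVu] := dich _ Au.
      have nv : \forall v \near u, V^° (g v).
        by apply: (cgu V^°); apply: open_nbhs_nbhs; split => //; exact: open_interior.
      by near=> v => _; split => // _; near: v.
    have nv : \forall v \near u, ~ closure V (g v).
      apply: (cgu (~` closure V)); apply: open_nbhs_nbhs; split => //.
      by apply: closed_openC; exact: closed_closure.
    near=> v => _; have nVv : ~ closure V (g v) by near: v.
    by split => [/interior_subset/subset_closure //|/interior_subset/subset_closure /nVu].
  exact: (connected_ind (@unit_interval_ball_connected t0 e) step At1 At Vt1).
apply: filterS nA => t /AV/interior_subset/subset_closure Vt.
by have [] := VN _ Vt.
Unshelve. all: by end_near. Qed.

End open_arc_limit.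

(** * Belyi maps as coverings, and their edges *)

Section belyi_covering.
Context (R : realType) (beta : P1 R -> P1 R).
Hypothesis Hbeta : dynamical_belyi beta.
Local Notation I := (I01 R).
Local Notation C := (R[i]^o).
Local Open Scope complex_scope.

Lemma belyi_continuous : continuous beta.
Proof. by case: Hbeta => -[[tay _] _] _ a; have [c /taylor_continuous] := tay a. Qed.

Lemma P1_compact : compact [set: P1 R].
Proof. exact: one_point_compactification_compact. Qed.

Lemma belyi_isolated a :
  (\forall y \near a, beta y = beta a) \/ (\forall y \near a, beta y = beta a -> y = a).
Proof. by case: Hbeta => -[[tay _] _] _; have [c /taylor_isolated] := tay a. Qed.

Lemma belyi_evenly_covered z : ~ special z -> evenly_covered beta z.
Proof.
move=> nz; apply: etale_evenly_covered.
- exact: P1_compact.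
- exact: P1_hausdorff.
- exact: belyi_continuous.
- move=> y yz; apply: unbranched_etale.
  by case: Hbeta => -[_ unb] _; apply: unb; rewrite yz.
Qed.

(** The dynamical condition enters here: it keeps lifts of paths of [Pstar] inside [Pstar]. *)
Lemma nonspecial_lift z : ~ special (beta z) -> ~ special z.
Proof. by move=> nz sz; apply: nz; case: Hbeta => _; apply; exists z. Qed.

Lemma lift_exists (p : I -> P1 R) (y : P1 R) : continuous p -> beta y = p zero ->
  (forall t, ~ special (p t)) ->
  exists q : I -> P1 R, [/\ continuous q, q zero = y & forall t, beta (q t) = p t].
Proof.
move=> cp yp np; apply: path_lift_exists => // t.
exact: belyi_evenly_covered.
Qed.

Lemma lift_eq (q q' : I -> P1 R) (t0 : I) : continuous q -> continuous q' ->
  (forall t, ~ special (beta (q t))) -> (forall t, beta (q t) = beta (q' t)) ->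
  q t0 = q' t0 -> q = q'.
Proof.
move=> cq cq' nq qq' E0; apply/funext => t.
apply: (lift_unique (f := beta) (A := [set: I]) (t0 := t0)) => //.
- exact: P1_hausdorff.
- exact: I01_connected.
- by move=> u _; exact: cq.
- by move=> u _; exact: cq'.
- by move=> u _; apply: evenly_covered_etale; exact: belyi_evenly_covered.
Qed.

Lemma real_nonspecial (t : R) : 0 < t < 1 -> ~ special (pt t%:C).
Proof.
move=> /andP[t0 t1] [[[E]|[E]]|//]; move: t0 t1; rewrite E ?ltxx //.
Qed.

Lemma real_pt_continuous : continuous (fun t : R => pt t%:C).
Proof.
apply: (@continuous_funcomp R C (P1 R) (fun t : R => t%:C) (@pt R)).
  exact: real_complex_continuous.
exact: one_point_compactification_some_continuous.
Qed.

Lemma half_in01 : 0 < (2^-1 : R) < 1.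
Proof. by apply/andP; split; lra. Qed.

Lemma ival_half : ival (clamp (2^-1 : R)) = 2^-1.
Proof. by rewrite clampK //; lra. Qed.

Lemma open_interval_near (t : I) (N : set I) : nbhs t N ->
  exists2 u, 0 < ival u < 1 & N u.
Proof.
move=> /I01_nbhsP[e e0 eN].
pose d := Num.min 1 e; have d0 : 0 < d by rewrite lt_min ltr01 e0.
have d1 : d <= 1 by rewrite ge_min lexx.
have de : d <= e by rewrite ge_min lexx orbT.
have t0 := ival_ge0 t; have t1 := ival_le1 t.
have E : ival (clamp ((1 - d) * ival t + d / 2)) = (1 - d) * ival t + d / 2.
  by rewrite clampK //; apply/andP; split; nra.
exists (clamp ((1 - d) * ival t + d / 2)); rewrite ?E; first by apply/andP; split; nra.
by apply: eN; rewrite E ltr_norml; apply/andP; split; nra.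
Qed.

Lemma edge_ext (e e' : edge beta) : e =1 e' -> e = e'.
Proof.
case: e e' => [f cf fP] [g cg gP] /= /funext E; rewrite -{}E in cg gP *.
by congr Edge; exact: Prop_irrelevance.
Qed.

(** Unique lifting is applied over the open interval, since [beta] may branch over 0 and 1; the ends
    agree by continuity, interior parameters being dense. *)
Lemma edge_mid_inj (e e' : edge beta) : edge_mid e = edge_mid e' -> e = e'.
Proof.
move=> E; apply: edge_ext.
have EA u : 0 < ival u < 1 -> e u = e' u.
  move=> u01.
  apply: (lift_unique (f := beta) (A := [set u : I | `|ival u - 2^-1| < 2^-1])
    (t0 := clamp 2^-1)) => //.
  - exact: P1_hausdorff.
  - exact: I01_ball_connected.
  - by move=> v _; exact: edge_continuous.
  - by move=> v _; exact: edge_continuous.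
  - by move=> v _; rewrite !edgeP.
  - move=> v /= v01; apply: evenly_covered_etale; apply: belyi_evenly_covered.
    rewrite edgeP; apply: real_nonspecial; move: v01; rewrite ltr_distl; lra.
  - by rewrite /= ival_half subrr normr0 invr_gt0.
  - by rewrite /= ltr_distl; lra.
move=> t; apply: P1_hausdorff => A B At Bt.
have nAB : \forall u \near t, (A (e u)) /\ B (e' u).
  have nA : \forall u \near t, A (e u) := edge_continuous At.
  have nB : \forall u \near t, B (e' u) := edge_continuous Bt.
  by near=> u; split; near: u.
have [u u01 [Au Bu]] := open_interval_near nAB.
by exists (e u); split => //; rewrite EA.
Unshelve. all: by end_near. Qed.

Lemma edge_exists (y : P1 R) : beta y = pt (2^-1)%:C ->
  exists e : edge beta, edge_mid e = y.
Proof.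
move=> yh.
(* Path lifting takes paths on the closed interval [I], so the open arc is assembled from ends of
   lifts: [K (s, _)] runs from 1/2 to [s], and [g s] is the end of its lift from [y]. *)
pose K (u : R * I) : P1 R := pt (2^-1 + ival u.2 * (u.1 - 2^-1))%:C.
have cK : continuous K.
  apply: (@continuous_funcomp (R * I)%type R (P1 R)
    (fun u : R * I => 2^-1 + ival u.2 * (u.1 - 2^-1)) (fun t => pt t%:C)); last first.
    exact: real_pt_continuous.
  have c1 : continuous (fst : R * I -> R) by move=> u; exact: cvg_fst.
  have c2 : continuous (snd : R * I -> I) by move=> u; exact: cvg_snd.
  by continuity.
have Kns s t : 0 < s < 1 -> ~ special (K (s, t)).
  move=> /andP[s0 s1]; apply: real_nonspecial => /=.
  have t0 := ival_ge0 t; have t1 := ival_le1 t.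
  by apply/andP; split; nra.
have K0 s : K (s, zero) = pt (2^-1)%:C by rewrite /K /= ival0 mul0r addr0.
have K1 s : K (s, one) = pt s%:C by rewrite /K /= ival1 mul1r addrC subrK.
have /choice[L HL] : forall s : R, exists q : I -> P1 R, 0 < s < 1 ->
    [/\ continuous q, q zero = y & forall t, beta (q t) = K (s, t)].
  move=> s; have [s01|] := boolP (0 < s < 1); last by exists (cst y).
  have [| |t|q] := @lift_exists (fun t => K (s, t)) y.
  - apply: (continuous_funcomp (k := fun t => (s, t))) => //.
    by apply: continuous_pairf; [exact: continuous_cstf | move=> ?; exact: cvg_id].
  - by rewrite K0.
  - exact: Kns.
  - by exists q.
pose g s := L s one.
have near01 (s : R) : 0 < s < 1 -> \forall s' \near s, 0 < s' < 1.
  move=> /andP[s0 s1]; have := lt_nbhsl s1; have := lt_nbhsr s0.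
  by apply: filterS2 => s' -> ->.
have cg s : 0 < s < 1 -> {for s, continuous g}.
  move=> s01.
  have J := @lift_jointly_continuous R (P1 R) (P1 R) beta belyi_continuous
    (@P1_hausdorff R) R K L s.
  have {}J : {for (s, one), continuous (fun u : R * I => L u.1 u.2)}.
    apply: J.
    - by move=> t; exact: cK.
    - by apply: filterS (near01 _ s01) => s' /HL[].
    - by apply: filterS (near01 _ s01) => s' /HL[].
    - by move=> t; apply: belyi_evenly_covered; exact: Kns.
    - apply: (@cvg_trans _ (cst y @ s)); last first.
        by have [_ -> _] := HL _ s01; exact: (@cst_continuous R (P1 R) y s).
      have E0 : \forall s' \near s, (cst y : R -> P1 R) s' = L s' zero.
        near=> s'; have s'01 : 0 < s' < 1 by near: s'; exact: near01.
        by have [_ -> _] := HL _ s'01.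
      exact: near_eq_cvg E0.
  apply: (@continuous_comp _ _ _ (fun s => (s, one : I)) (fun u => L u.1 u.2)) => //.
  apply: continuous_pairf; last exact: continuous_cstf.
  by move=> ?; exact: cvg_id.
have bg s : 0 < s < 1 -> beta (g s) = pt s%:C.
  by move=> /HL[_ _ H]; rewrite /g H K1.
have gh : g 2^-1 = y.
  have [cL L0 LK] := HL _ half_in01.
  rewrite /g (@lift_eq (L 2^-1) (cst y) zero) //.
  - exact: continuous_cstf.
  - by move=> t; rewrite LK; exact: Kns half_in01.
  - by move=> t; rewrite LK /K /= subrr mulr0 addr0.
have lim t0 : 0 <= t0 <= 1 -> ~~ (0 < t0 < 1) ->
    exists2 y, beta y = pt t0%:C & g @ within `]0, 1[%classic (nbhs t0) --> y.
  move=> t001 nt0.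
  apply: (open_arc_limit P1_compact (@P1_hausdorff R) (@P1_hausdorff R) belyi_continuous t001 cg bg).
  - exact: real_pt_continuous.
  - by move=> t t01 [E]; rewrite -E t01 in nt0.
  - exact: belyi_isolated.
have [||y0 by0 cy0] := lim 0; rewrite ?lexx ?ler01 ?ltxx //.
have [||y1 by1 cy1] := lim 1; rewrite ?lexx ?ler01 ?ltxx ?andbF //.
pose e (t : I) : P1 R := if ival t == 0 then y0 else if ival t == 1 then y1 else g (ival t).
have eE (t : I) : 0 < ival t < 1 -> e t = g (ival t).
  by move=> /andP[t0 t1]; rewrite /e gt_eqF // lt_eqF.
have cases (t : I) : [\/ ival t = 0, ival t = 1 | 0 < ival t < 1].
  have := ival_ge0 t; rewrite le_eqVlt => /predU1P[<-|t0]; first by constructor 1.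
  have := ival_le1 t; rewrite le_eqVlt => /predU1P[<-|t1]; first by constructor 2.
  by constructor 3; rewrite t0.
have ce : continuous e.
  (* Within distance 1 of an end the opposite end is excluded, which leaves the end itself and
     interior parameters. *)
  have endpoint t t0 y' : ival t = t0 -> (t0 = 0 \/ t0 = 1) -> e t = y' ->
      g @ within `]0, 1[%classic (nbhs t0) --> y' -> {for t, continuous e}.
    move=> tt0 t001 et cy N; rewrite et => Ny'.
    have n0 : \forall s \near ival t, 0 < s < 1 -> N (g s).
      have H : \forall s \near within `]0, 1[%classic (nbhs t0), N (g s) := cy _ Ny'.
      rewrite near_withinE -tt0 in H.
      by apply: filterS H => s Hs s01; apply: Hs; rewrite /= in_itv.
    have n1 : \forall u \near t, 0 < ival u < 1 -> N (g (ival u)) := ival_continuous n0.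
    have n2 : \forall u \near t, `|ival u - ival t| < 1 by apply: I01_near.
    suff : \forall u \near t, N (e u) by [].
    near=> u.
    have u1 : 0 < ival u < 1 -> N (g (ival u)) by near: u.
    have u2 : `|ival u - ival t| < 1 by near: u.
    have [u0|u0|u01] := cases u; last by rewrite eE //; exact: u1.
    - have ut : u = t.
        apply: ival_inj; rewrite u0 tt0; case: t001 => // t01.
        by move: u2; rewrite u0 tt0 t01 sub0r normrN normr1 ltxx.
      by rewrite ut et; exact: nbhs_singleton.
    - have ut : u = t.
        apply: ival_inj; rewrite u0 tt0; case: t001 => // t01.
        by move: u2; rewrite u0 tt0 t01 subr0 normr1 ltxx.
      by rewrite ut et; exact: nbhs_singleton.
  move=> t; have [t0|t1|t01] := cases t.
  - by apply: (endpoint t 0 y0) => //; [left | rewrite /e t0 eqxx].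
  - by apply: (endpoint t 1 y1) => //; [right | rewrite /e t1 oner_eq0 eqxx].
  apply: (@cvg_trans _ ((fun u => g (ival u)) @ t)).
    have E0 : \forall u \near t, g (ival u) = e u.
      have H : \forall u \near t, 0 < ival u < 1 := ival_continuous (near01 _ t01).
      by apply: filterS H => u /eE.
    exact: near_eq_cvg E0.
  rewrite eE //; apply: (@continuous_comp _ _ _ (@ival R) g); last exact: cg.
  exact: ival_continuous.
have be (t : I) : beta (e t) = pt (ival t)%:C.
  have [t0|t1|t01] := cases t; last by rewrite eE // bg.
  - by rewrite /e t0 eqxx.
  - by rewrite /e t1 oner_eq0 eqxx.
exists (Edge ce be); rewrite /edge_mid /= eE ival_half //; exact: half_in01.
Unshelve. all: by end_near. Qed.

End belyi_covering.

(** * Groupoid laws for paths with varying ends *)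

Section path_groupoid.
Context (R : realType) (X : topologicalType).
Local Notation I := (I01 R).
Local Notation "x ~~> y" := {path I from x to y in X} (at level 70).

Local Ltac solve_minmax :=
  repeat match goal with
  | |- context [Order.min ?a ?b] =>
    lazymatch constr:((a, b)) with
    | context [Order.min _ _] => fail
    | _ => case: (leP a b) => ?
    end
  | |- context [Order.max ?a ?b] => case: (leP a b) => ?
  end; lra.

(** The map [g] carries the breakpoints 1/4 and 1/2 of the left side to 1/2 and 3/4; its slopes 2, 1
    and 1/2 decrease, so it is a minimum of three lines. *)
Lemma homotopic_concA (x y z w : X) (p : x ~~> y) (q : y ~~> z) (r : z ~~> w) :
  homotopic (conc_path (conc_path p q) r) (conc_path p (conc_path q r)).
Proof.
pose g (t : I) :=
  Num.min (2 * ival t) (Num.min (ival t + 4^-1) (2^-1 * (ival t + 1))).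
apply: (homotopic_reparam (p := conc_path p (conc_path q r)) (g := g) (h := @ival R)).
- by rewrite /g; continuity.
- by continuity.
- by rewrite /g !ival0; solve_minmax.
- by rewrite /g !ival1; solve_minmax.
- move=> t; have t0 := ival_ge0 t; have t1 := ival_le1 t.
  have gt01 : 0 <= g t <= 1 by rewrite /g; apply/andP; split; solve_minmax.
  rewrite !conc_pathE (clampK gt01).
  have [th|th] := leP (ival t) 2^-1.
    rewrite (@clampK _ (2 * ival t)); last by lra.
    have [tq|tq] := leP (2 * ival t) 2^-1.
      have -> : g t = 2 * ival t by rewrite /g; solve_minmax.
      by rewrite tq.
    have -> : g t = ival t + 4^-1 by rewrite /g; solve_minmax.
    rewrite ifF; last by apply/negbTE; rewrite -ltNge; lra.
    rewrite clampK; last by lra.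
    rewrite ifT; last by lra.
    by congr (q (clamp _)); lra.
  have -> : g t = 2^-1 * (ival t + 1) by rewrite /g; solve_minmax.
  rewrite ifF; last by apply/negbTE; rewrite -ltNge; lra.
  rewrite clampK; last by lra.
  rewrite ifF; last by apply/negbTE; rewrite -ltNge; lra.
  by congr (r (clamp _)); lra.
- by move=> t; rewrite ivalK.
Qed.

Lemma homotopic_cst_conc (x y : X) (p : x ~~> y) :
  homotopic (conc_path (cst x : x ~~> x) p) p.
Proof.
apply: (homotopic_reparam (p := p) (g := fun t : I => Num.max 0 (2 * ival t - 1))
  (h := @ival R)).
- by continuity.
- by continuity.
- by rewrite !ival0; solve_minmax.
- by rewrite !ival1; solve_minmax.
- move=> t; rewrite conc_pathE; have [th|th] := leP (ival t) 2^-1; last by rewrite max_r //; lra.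
  by rewrite max_l; [rewrite [RHS](@path_zero _ _ _ _ p) | lra].
- by move=> t; rewrite ivalK.
Qed.

Lemma homotopic_conc_rev (x y : X) (p : x ~~> y) :
  homotopic (conc_path p (Defs.rev_path p)) (cst x : x ~~> x).
Proof.
apply: (homotopic_reparam (p := p)
  (g := fun t : I => Num.min (2 * ival t) (2 - 2 * ival t)) (h := fun _ : I => 0)).
- by continuity.
- by continuity.
- by rewrite !ival0; solve_minmax.
- by rewrite !ival1; solve_minmax.
- move=> t; have t1 := ival_le1 t; have t0 := ival_ge0 t.
  rewrite conc_pathE; have [th|th] := leP (ival t) 2^-1; first by rewrite min_l //; lra.
  rewrite Defs.rev_pathE clampK; last by lra.
  by congr (p (clamp _)); rewrite min_r; lra.
- by move=> t; rewrite [RHS](@path_zero _ _ _ _ p).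
Qed.

Lemma homotopic_conc_cancel (x y z : X) (p : x ~~> y) (q : x ~~> z) :
  homotopic (conc_path p (conc_path (Defs.rev_path p) q)) q.
Proof.
apply: homotopic_trans (homotopic_sym (homotopic_concA _ _ _)) _.
apply: homotopic_trans (homotopic_conc (homotopic_conc_rev _) (homotopic_refl _)) _.
exact: homotopic_cst_conc.
Qed.

End path_groupoid.

(** * Closing up paths to loops at the base point *)

Section closing_up.
Context (R : realType).
Local Notation I := (I01 R).
Local Notation "x ~~> y" := {path I from x to y in Pstar R} (at level 70).

(** [based_loop] reads its ends off a bare continuous function; carrying them as indices lets
    homotopies of paths act on it. *)
Definition close_path (x y : Pstar R) (p : x ~~> y) : base_pt R ~~> base_pt R :=
  conc_path (Defs.rev_path (path_to_half x)) (conc_path p (path_to_half y)).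

Lemma based_loopE (x y : Pstar R) (p : x ~~> y) (q : continuousType I (Pstar R)) :
  q =1 p -> based_loop q = close_path p.
Proof.
move=> qp; have q0 : q zero = x by rewrite qp path_zero.
have q1 : q one = y by rewrite qp path_one.
apply/path_eqP => t; rewrite !conc_pathE.
case: ifP => _; first by rewrite !Defs.rev_pathE q0.
by case: ifP => _; [exact: qp | rewrite q1].
Qed.

Lemma close_path_homotopic (x y : Pstar R) (p q : x ~~> y) :
  homotopic p q -> homotopic (close_path p) (close_path q).
Proof.
move=> pq; apply: homotopic_conc; first exact: homotopic_refl.
by apply: homotopic_conc => //; exact: homotopic_refl.
Qed.

(** The arc from [y] to the base point that ends the first loop cancels against its reverse, which
    starts the second. *)
Lemma close_path_conc (x y z : Pstar R) (p : x ~~> y) (q : y ~~> z) :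
  homotopic (conc_path (close_path p) (close_path q)) (close_path (conc_path p q)).
Proof.
have cong_r (u v w : Pstar R) (a : u ~~> v) (b c : v ~~> w) :
    homotopic b c -> homotopic (conc_path a b) (conc_path a c).
  by move=> bc; apply: homotopic_conc => //; exact: homotopic_refl.
apply: homotopic_trans (homotopic_concA _ _ _) _; apply: (@cong_r).
apply: homotopic_trans (homotopic_concA _ _ _) _.
apply: homotopic_sym; apply: homotopic_trans (homotopic_concA _ _ _) _; apply: (@cong_r).
by apply: homotopic_sym; exact: homotopic_conc_cancel.
Qed.

End closing_up.

(** * Lifts in the punctured sphere *)

Section lifts.
Context (R : realType) (beta : P1 R -> P1 R).
Hypothesis Hbeta : dynamical_belyi beta.
Local Notation I := (I01 R).
Local Notation Ps := (Pstar R).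

Lemma pstar_val_continuous : continuous (@pstar_val R).
Proof. exact: initial_continuous. Qed.

Lemma pstar_valP (x : Ps) : ~ special (pstar_val x).
Proof. exact: set_mem (valP x). Qed.

Lemma pstar_val_inj : injective (@pstar_val R).
Proof. exact: val_inj. Qed.

Lemma pstar_factor (T : topologicalType) (g : T -> P1 R) :
  continuous g -> (forall t, ~ special (g t)) ->
  exists2 h : T -> Ps, continuous h & forall t, pstar_val (h t) = g t.
Proof.
move=> cg ng; exists (fun t => mkPstar (@mem_set _ (~` @special R) _ (ng t))) => //.
exact: (@continuous_comp_initial _ T (P1 R) (@pstar_val R)).
Qed.

Lemma pstar_comp_continuous (T : topologicalType) (g : T -> Ps) :
  continuous g -> continuous (fun t => pstar_val (g t)).
Proof. by move=> cg; apply: continuous_funcomp => //; exact: pstar_val_continuous. Qed.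

Lemma is_lift_exists (p : continuousType I Ps) (y : P1 R) :
  beta y = pstar_val (p zero) ->
  exists q : continuousType I Ps, is_lift beta p y q.
Proof.
move=> yp; have cp := pstar_comp_continuous (@cts_fun _ _ p).
have [|q [cq q0 qp]] := lift_exists Hbeta cp yp; first by move=> t; exact: pstar_valP.
have [t|h ch hq] := pstar_factor cq.
  by apply: (nonspecial_lift Hbeta); rewrite qp; exact: pstar_valP.
exists (mk_path ch erefl erefl); split; first by rewrite /mk_path hq.
by move=> t; rewrite /mk_path hq.
Qed.

(** The homotopy is lifted slice by slice and [lift_jointly_continuous] makes the result continuous.
    As [q] and [q'] are bare functions, their having the same ends has to be produced too, through
    the indices [a] and [b]. *)
Lemma is_lift_homotopic (x z : Ps) (p p' : {path I from x to z in Pstar R}) (y : P1 R)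
    (q q' : continuousType I Ps) : homotopic p p' ->
  is_lift beta p y q -> is_lift beta p' y q' ->
  exists a b (u v : {path I from a to b in Pstar R}), [/\ q =1 u, q' =1 v & homotopic u v].
Proof.
move=> [H [cH H0 H1 Hx Hz]] [q0 qp] [q'0 q'p].
pose K (w : I * I) := pstar_val (H w).
have cK : continuous K by exact: pstar_comp_continuous.
have nK w : ~ special (K w) by exact: pstar_valP.
have yx s : beta y = K (s, zero) by rewrite /K Hx -q0 qp path_zero.
have cKs (s : I) : continuous (fun t => K (s, t)).
  apply: (continuous_funcomp (k := fun t => (s, t))) => //.
  by apply: continuous_pairf; [exact: continuous_cstf | move=> ?; exact: cvg_id].
have /choice[L HL] : forall s : I, exists l : I -> P1 R,
    [/\ continuous l, l zero = y & forall t, beta (l t) = K (s, t)].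
  by move=> s; exact: (lift_exists Hbeta).
have cL : continuous (fun w => L w.1 w.2).
  move=> [s t].
  have J := @lift_jointly_continuous R _ _ beta (belyi_continuous Hbeta)
    (@P1_hausdorff R) _ K L s.
  apply: J.
  - by move=> t'; exact: cK.
  - by near=> s'; have [] := HL s'.
  - by near=> s'; have [] := HL s'.
  - by move=> t'; exact: belyi_evenly_covered.
  - rewrite (_ : (fun s => L s zero) = cst y); first exact: cst_continuous.
    by apply/funext => s'; have [] := HL s'.
have nL w : ~ special (L w.1 w.2).
  by apply: (nonspecial_lift Hbeta); have [_ _ ->] := HL w.1.
have [G cG GL] := pstar_factor cL nL.
have liftE s (r : I -> Ps) : continuous r -> pstar_val (r zero) = y ->
    (forall t, beta (pstar_val (r t)) = K (s, t)) -> forall t, r t = G (s, t).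
  move=> cr r0 rK t; apply: pstar_val_inj; rewrite GL /=.
  have [cLs L0 LK] := HL s.
  have E : (fun t => pstar_val (r t)) = L s.
    apply: (lift_eq Hbeta (t0 := zero)) => [|//|u|u|].
    - exact: pstar_comp_continuous.
    - by rewrite rK; exact: nK.
    - by rewrite rK LK.
    - by rewrite r0 L0.
  by move: (congr1 (fun k => k t) E).
have qG : forall t, q t = G (zero, t).
  by apply: liftE => // [|t]; [exact: cts_fun | rewrite qp /K H0].
have q'G : forall t, q' t = G (one, t).
  by apply: liftE => // [|t]; [exact: cts_fun | rewrite q'p /K H1].
have G0 s : G (s, zero) = q zero.
  by apply: pstar_val_inj; rewrite GL q0; have [] := HL s.
(* The ends of the slices form a lift of the constant path at [z], hence do not move. *)
have G1 s : G (s, one) = q one.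
  have E : (fun s => L s one) = (fun=> L zero one).
    apply: (lift_eq Hbeta (t0 := zero)) => [||u|u|//].
    - apply: (continuous_funcomp (k := fun s => (s, one)) (h := fun w => L w.1 w.2)) => //.
      by apply: continuous_pairf; [move=> ?; exact: cvg_id | exact: continuous_cstf].
    - exact: continuous_cstf.
    - by have [_ _ ->] := HL u; exact: nK.
    - by have [_ _ ->] := HL u; have [_ _ ->] := HL zero; rewrite /K !Hz.
  apply: pstar_val_inj; rewrite qG !GL /=.
  exact: (congr1 (fun k => k s) E).
have q'0E : q' zero = q zero by rewrite q'G G0.
have q'1E : q' one = q one by rewrite q'G G1.
exists (q zero), (q one), (mk_path (@cts_fun _ _ q) erefl erefl),
  (mk_path (@cts_fun _ _ q') q'0E q'1E); split => //.
by exists G; split => // t; rewrite ?[RHS]qG ?[RHS]q'G.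
Unshelve. all: by end_near. Qed.

End lifts.

(** * Monodromy and extending patterns *)

Section monodromy_action.
Context (R : realType) (beta : P1 R -> P1 R).
Hypothesis Hbeta : dynamical_belyi beta.
Local Notation I := (I01 R).
Local Notation loop := {path I from base_pt R to base_pt R in Pstar R}.
Local Notation pi1Z := (pi1_star R).
Implicit Types (l : pi1Z) (e : edge beta).

Lemma edge_midE e : beta (edge_mid e) = pstar_val (base_pt R).
Proof. by rewrite /edge_mid edgeP ival_half. Qed.

Lemma lift_atP l e : is_lift beta (repr l) (edge_mid e) (lift_at l e).
Proof.
pose S := [set q : continuousType I (Pstar R) | is_lift beta (repr l) (edge_mid e) q].
suff : S (path_lift beta (repr l) (edge_mid e)) by [].
apply: xgetPex; apply: (is_lift_exists Hbeta (p := repr l)).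
by rewrite edge_midE; congr pstar_val; exact/esym/(@path_zero _ _ _ _ (repr l : loop)).
Qed.

(** Independence of choices: [repr l] may be traded for any loop [p] of the class, and the selected
    lift for any lift of [p]. *)
Lemma lift_at_homotopic l e (p : loop) (q : continuousType I (Pstar R)) :
  pi1_class p = l -> is_lift beta p (edge_mid e) q ->
  lift_at l e one = q one /\
  forall x z (u : {path I from x to z in Pstar R}), q =1 u ->
    extending_pattern l e = pi1_class (close_path u).
Proof.
move=> pl qp.
have rp : homotopic (repr l) p by apply/pi1_classP; rewrite pl; exact: pi1_reprK.
have [x [z [u [v [lu qv uv]]]]] := is_lift_homotopic Hbeta rp (lift_atP l e) qp.
split; first by rewrite lu qv !path_one.
move=> x' z' w qw; rewrite /extending_pattern (based_loopE lu) -(based_loopE qw).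
rewrite (based_loopE qv); apply/pi1_classP; exact: close_path_homotopic.
Qed.

(** The edge is picked to meet the end of the lift at some parameter; [beta] is 1/2 there and an
    edge is a section of [beta], so that parameter is 1/2. *)
Lemma edge_act_mid l e : edge_mid (edge_act l e) = pstar_val (lift_at l e one).
Proof.
have bl : beta (pstar_val (lift_at l e one)) = pt (2^-1)%:C%C.
  by have [_ ->] := lift_atP l e; rewrite (@path_one _ _ _ _ (repr l : loop)).
have [e0 e0E] := edge_exists Hbeta bl.
have [t et] : exists t, edge_act l e t = pstar_val (lift_at l e one).
  pose S := [set e' : edge beta | exists t, e' t = pstar_val (lift_at l e one)].
  suff : S (xget e S) by [].
  by apply: xgetPex; exists e0; exists (clamp 2^-1).
have := edgeP (edge_act l e) t; rewrite et bl => -[th].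
by rewrite -et /edge_mid; congr (_ _); apply: ival_inj; rewrite ival_half.
Qed.

(** One concatenated lift yields both identities, which are the rules for the two components of a
    product in the wreath product. By [edge_act_mid] the second lift starts where the first ends. *)
Lemma monodromy_mul l1 l2 e :
  edge_act (l1 * l2)%g e = edge_act l2 (edge_act l1 e) /\
  extending_pattern (l1 * l2)%g e =
    (extending_pattern l1 e * extending_pattern l2 (edge_act l1 e))%g.
Proof.
set q1 := lift_at l1 e; set q2 := lift_at l2 (edge_act l1 e).
have [q10 q1p] := lift_atP l1 e; have [q20 q2p] := lift_atP l2 (edge_act l1 e).
have q12 : q2 zero = q1 one by apply: pstar_val_inj; rewrite q20 edge_act_mid.
pose u1 := mk_path (@cts_fun _ _ q1) erefl erefl : {path I from q1 zero to q1 one in Pstar R}.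
pose u2 := mk_path (@cts_fun _ _ q2) q12 erefl : {path I from q1 one to q2 one in Pstar R}.
pose u := conc_path u1 u2 : {path I from q1 zero to q2 one in Pstar R}.
have lq : is_lift beta (conc_path (repr l1) (repr l2)) (edge_mid e) u.
  split; first by rewrite (@path_zero _ _ _ _ u).
  by move=> t; rewrite !conc_pathE; case: ifP => _; [exact: q1p | exact: q2p].
have [E1 E2] := lift_at_homotopic erefl lq.
split.
  apply: (edge_mid_inj Hbeta); rewrite !edge_act_mid E1.
  by congr pstar_val; exact: (@path_one _ _ _ _ u).
rewrite (E2 _ _ u) //.
rewrite /extending_pattern -/q1 -/q2 (@based_loopE _ _ _ u1) // (@based_loopE _ _ _ u2) //.
rewrite [RHS]pi1_mulE; apply/esym/pi1_classP; exact: close_path_conc.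
Qed.

Lemma edge_act_one e : edge_act 1%g e = e.
Proof.
apply: (edge_mid_inj Hbeta); rewrite edge_act_mid.
have [q0 qp] := lift_atP 1%g e.
set x := lift_at 1%g e zero in q0 qp.
have lx : is_lift beta (cst (base_pt R) : loop) (edge_mid e) (cst x : continuousType I _).
  by split => // t; rewrite [pstar_val _]q0 edge_midE.
have [-> _] := lift_at_homotopic erefl lx.
exact: q0.
Qed.

(** [sym_of] falls back on the identity for a map that is not bijective; the action of [l^-1]
    provides the inverse that excludes this. *)
Lemma rhoE l e : rho beta l e = edge_act l e.
Proof.
have lK m : cancel (edge_act (beta := beta) m) (edge_act m^-1%g).
  by move=> e'; rewrite -(monodromy_mul _ _ _).1 mulgV edge_act_one.
have lVK : cancel (edge_act (beta := beta) l^-1%g) (edge_act l).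
  by move=> e'; rewrite -(monodromy_mul _ _ _).1 mulVg edge_act_one.
suff -> : sym_fun (rho beta l) = edge_act l by [].
rewrite /rho /sym_of.
apply: (@xgetPex _ 1%g [set s : Sym (edge beta) | sym_fun s = edge_act l]).
by exists (MkSym (lK l) lVK).
Qed.

Lemma rho_mul : {morph rho beta : l1 l2 / (l1 * l2)%g}.
Proof.
move=> l1 l2; apply: Sym_ext => e; rewrite rhoE (monodromy_mul l1 l2 e).1.
by rewrite -!rhoE.
Qed.

Lemma phi_mul : {morph phi beta : l1 l2 / (l1 * l2)%g}.
Proof.
move=> l1 l2; rewrite /phi.
have -> : tau beta (l1 * l2)%g = (tau beta l1 * tau beta l2)%g.
  by apply: subg_val_inj; exact: rho_mul.
congr Wreath; apply/funext => e; rewrite (monodromy_mul l1 l2 e).2.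
by rewrite -rhoE.
Qed.

End monodromy_action.

(** * First isomorphism theorem on a subgroup *)

Section first_isomorphism.
Context (G H : groupType) (f : G -> H) (E : set G).
Hypotheses (fM : {morph f : x y / (x * y)%g}) (gE : is_subgroup E).

Lemma morph1 : f 1%g = 1%g.
Proof. by apply: (@mulgI _ (f 1%g)); rewrite -fM !mulg1. Qed.

Lemma morphV x : f x^-1%g = (f x)^-1%g.
Proof. by apply: (@mulgI _ (f x)); rewrite -fM !mulgV morph1. Qed.

Let N := [set x | E x /\ f x = 1%g].

Lemma normal_morph_kernel : normal N E.
Proof.
have [E1 EM EV] := gE; split => //.
- split=> [|x y [Ex fx] [Ey fy]|x [Ex fx]].
  + by split => //; exact: morph1.
  + by split; [exact: EM | rewrite fM fx fy mulg1].
  + by split; [exact: EV | rewrite morphV fx invg1].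
- by move=> x [].
move=> n h [En fn] Eh; split; first by apply: (EM) => //; apply: (EM) => //; exact: EV.
by rewrite !fM fn mulg1 morphV mulVg.
Qed.

(** The cosets of [N] in [E] are the fibres of [f] over the image, a description free of
    representatives. *)
Let fibre (w : H) : gset G := [set x | E x /\ f x = w].

Let coset_fibre x : E x -> coset N x = fibre (f x).
Proof.
have [E1 EM EV] := gE; move=> Ex; apply/seteqP; split => [_ [n [En fn] <-]|y [Ey fy]].
  by split; [exact: EM | rewrite fM fn mulg1].
exists (x^-1 * y)%g; last by rewrite mulgA mulgV mul1g.
by split; [apply: EM => //; exact: EV | rewrite fM morphV fy mulVg].
Qed.

Let fibre_mul v w : (f @` E) v -> (f @` E) w -> fibre (v * w)%g = (fibre v * fibre w)%g.
Proof.
have [E1 EM EV] := gE; move=> [x Ex fx] [y Ey fy]; apply/seteqP; split => z.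
  move=> [Ez fz]; exists x; first by [].
  exists (x^-1 * z)%g; last by rewrite mulgA mulgV mul1g.
  by split; [apply: EM => //; exact: EV | rewrite fM morphV fx fz mulgA mulVg mul1g].
by move=> [a [Ea fa] [b [Eb fb] <-]]; split; [exact: EM | rewrite fM fa fb].
Qed.

Let fibre_bij : set_bij (f @` E) (quotient E N) fibre.
Proof.
split=> [_ [x Ex <-]|v w /set_mem[x Ex <-] /set_mem[y Ey <-] E'|_ [x Ex <-]].
- by exists x => //; exact: coset_fibre.
- by have : fibre (f x) x by []; rewrite E' => -[].
- by exists (f x); [exists x | rewrite coset_fibre].
Qed.

Lemma isog_image_quotient : isog (f @` E) (quotient E N).
Proof. by exists fibre => // v w; exact: fibre_mul. Qed.

(** [isog] is witnessed by a map in one direction, so the inverse is built separately: [f] at an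
    element chosen in the coset. *)
Lemma isog_quotient_image : isog (quotient E N) (f @` E).
Proof.
pose g (A : gset G) := f (xget 1%g A).
have gK w : (f @` E) w -> g (fibre w) = w.
  move=> [x Ex fx]; suff : fibre w (xget 1%g (fibre w)) by case.
  by apply: xgetPex; exists x.
have quot A : quotient E N A -> exists2 w, (f @` E) w & A = fibre w.
  by move=> [x Ex <-]; exists (f x); [exists x | exact: coset_fibre].
exists g => [|A B /quot[v Dv ->] /quot[w Dw ->]]; last first.
  rewrite -fibre_mul // !gK //.
  move: Dv Dw => [x Ex <-] [y Ey <-]; exists (x * y)%g; last exact: fM.
  by have [_ EM _] := gE; exact: EM.
split=> [A /quot[w Dw ->]|A B /set_mem/quot[v Dv ->] /set_mem/quot[w Dw ->]|w Dw].
- by rewrite gK.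
- by rewrite !gK // => ->.
- exists (fibre w); last exact: gK.
  by move: Dw => [x Ex <-]; exists x => //; exact: coset_fibre.
Qed.

End first_isomorphism.

(* The import of GRing.Theory shadows monoid_morphism by its semiring version. *)
From mathcomp Require Import monoid.

Local Open Scope group_scope.

Theorem theorem4p1 (R : realType) (beta : P1 R -> P1 R)
    (Hbeta : dynamical_belyi beta) :
  let image := range (phi beta) in
  let ker_proj := [set w | image w /\ wreath_proj w = 1] in
  [/\ Mon beta = range (rho beta) :> set _,
      monoid_morphism (phi beta),
      is_extension (subg (Mon beta)) image ker_proj,
      ker_proj = phi beta @` kernel (rho beta) &
      normal (kernel (phi beta)) (kernel (rho beta)) /\
      isog (phi beta @` kernel (rho beta))
           (quotient (kernel (rho beta)) (kernel (phi beta)))].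
Proof.
move=> image ker_proj.
have rhoM := rho_mul Hbeta; have phiM := phi_mul Hbeta.
have MonE : Mon beta = range (rho beta) :> set _.
  exact/generated_id/morphism_image_subgroup.
have gimage : is_subgroup image by exact: morphism_image_subgroup.
have projM : {morph (@wreath_proj _ _ (Mon beta)) : u v / u * v} by [].
(* The generated subgroup is the range of [rho beta], so each of its elements comes from some [l],
   and [phi beta l] lies above it. *)
have proj_image : @wreath_proj _ _ (Mon beta) @` image = [set: subg (Mon beta)].
  apply/seteqP; split => // t _.
  have : (Mon beta : set _) (subg_val t) := subg_valP t.
  rewrite MonE => -[l _ lt]; exists (phi beta l); first by exists l.
  exact: subg_val_inj.
have tau1 l : tau beta l = 1 <-> rho beta l = 1.
  by split=> [/(congr1 (@subg_val _ _))|rl] //; exact: subg_val_inj.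
have gker : is_subgroup (kernel (rho beta)).
  have [gN _ _ _] := @normal_morph_kernel _ _ (rho beta) setT rhoM
    (And3 Logic.I (fun _ _ _ _ => Logic.I) (fun _ _ => Logic.I)).
  rewrite (_ : kernel _ = [set x | setT x /\ rho beta x = 1]) //.
  by apply/seteqP; split => [x kx|x []].
(* [tau] is the projection of [phi], so an element killed by [phi] is killed by [rho]. *)
have kphiE : [set l | kernel (rho beta) l /\ phi beta l = 1] = kernel (phi beta).
  apply/seteqP; split => [l []//|l phil]; split => //.
  by apply/tau1; rewrite -[tau beta l]/(wreath_proj (phi beta l)) phil.
split => //.
- by split => //; exact: morph1.
(* The first isomorphism theorem for the projection restricted to the image; for the last clause it
   is applied to [phi beta] on the kernel of [rho beta]. *)
- split; first exact: normal_morph_kernel.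
  by rewrite -proj_image; exact: isog_quotient_image.
- apply/seteqP; split => [_ [[l _ <-] /tau1 rl]|_ [l /tau1 rl <-]].
    by exists l.
  by split => //; exists l.
- by rewrite -kphiE; split; [exact: normal_morph_kernel | exact: isog_image_quotient].
Qed.
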